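(* Let $d \in \mathbb{N}$ (so $d \ge 1$), let $\mathbb{V}$ be a $d$-dimensional real vector space and let $\mathbb{L}$ be a lattice of rank $d$ in $\mathbb{V}$. Let $\mathcal{T}^d$ be the family of all $d$-dimensional lattice simplices $T$ in $\mathbb{V}$ (with respect to $\mathbb{L}$) whose interior contains precisely one point of $\mathbb{L}$. Then the following statements hold. I. For every $T \in \mathcal{T}^d$ there exist faces $G_1 \subseteq \cdots \subseteq G_d = T$ of $T$ such that, for every $i \in \{1,\ldots,d\}$, $G_i$ is $i$-dimensional and satisfies $$\mathrm{vol}_{\mathbb{L}}(G_i) \le \frac{1}{i!}(d+1)^{2^i-1} \qquad\text{and}\qquad |G_i \cap \mathbb{L}| \le i + (d+1)^{2^i-1}.$$ II. There exist $T' \in \mathcal{T}^d$ and faces $G_1 \subseteq \cdots \subseteq G_d = T'$ of $T'$ such that, for every $i \in \{1,\ldots,d\}$, $G_i$ is $i$-dimensional and satisfies $$\mathrm{vol}_{\mathbb{L}}(G_i) \ge \frac{1}{i!}\left(2^{2^{i-1}}-1\right) \qquad\text{and}\qquad |G_i \cap \mathbb{L}| \ge 2^{2^{i-2}}.$$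
   Context: A lattice polytope (with respect to $\mathbb{L}$) is the convex hull of finitely many points of $\mathbb{L}$; a lattice simplex is a simplex all of whose vertices are in $\mathbb{L}$. Fix coordinates, identifying $\mathbb{V}$ with $\mathbb{R}^d$. For an $i$-dimensional lattice polytope $P$ with $i \in \{1,\ldots,d\}$, $\mathrm{vol}(P)$ denotes its $i$-dimensional volume, and its $i$-dimensional normalized volume is $$\mathrm{vol}_{\mathbb{L}}(P) := \frac{\mathrm{vol}(P)}{\det \mathbb{M}},$$ where $\mathbb{M} := \mathbb{L} \cap X$, $X$ is the linear hull of all vectors $x-y$ with $x,y \in P$, and $\det \mathbb{M}$ is the determinant of the rank-$i$ lattice $\mathbb{M}$, i.e. the $i$-dimensional volume of a Dirichlet (Voronoi) cell of $\mathbb{M}$ in $X$, equivalently of a fundamental parallelepiped of $\mathbb{M}$. The value $\mathrm{vol}_{\mathbb{L}}(P)$ does not depend on the choice of coordinates. $|X|$ denotes the cardinality of a set $X$. *)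

(* Defs.v *)
From HB Require Import structures.
From mathcomp Require Import all_boot all_order all_algebra.
From mathcomp Require Import all_classical all_reals all_analysis.
Set Implicit Arguments.
Unset Strict Implicit.
Unset Printing Implicit Defensive.
Import Order.TTheory GRing.Theory Num.Theory.
Import numFieldNormedType.Exports.
Local Open Scope classical_set_scope.
Local Open Scope ring_scope.

(* n-dimensional Lebesgue measure, as the iterated product of the Lebesgue
   measure of the line: R^(n+1) is identified with R x R^n by (x, y) |-> x :: y,
   and R^0 = {[tuple]} carries the Dirac mass. *)
Fixpoint lebesgue_Rn (R : realType) (n : nat) :
    set (n.-tuple (measurableTypeR R)) -> \bar R :=
  match n return set (n.-tuple (measurableTypeR R)) -> \bar R with
  | 0 => fun A => \d_ [tuple] A
  | m.+1 => fun A =>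
      product_measure1 (@lebesgue_measure R) (@lebesgue_Rn R m)
        [set p : measurableTypeR R * m.-tuple (measurableTypeR R) |
            A [tuple of p.1 :: p.2]]
  end.

Section Polytopes.
Variables (R : realType) (V : vectType R).
Implicit Types (P T X L M : set V).

Definition conv_hull n (v : n.-tuple V) : set V :=
  [set x | exists c : 'I_n -> R,
     [/\ forall j, 0 <= c j, \sum_j c j = 1 & x = \sum_j c j *: tnth v j]].

Definition affinely_independent n (v : n.-tuple V) : Prop :=
  forall c : 'I_n -> R, \sum_j c j = 0 -> \sum_j c j *: tnth v j = 0 ->
  forall j, c j = 0.

(* The possibly improper or empty faces of P, cut out by valid inequalities;
   f = 0 gives P itself. *)
Definition is_face P F : Prop :=
  exists (f : {linear V -> R^o}) (h : R),
    (forall x, P x -> f x <= h) /\ F = P `&` [set x | f x = h].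

(* The linear hull of all vectors x - y with x, y in P. *)
Definition direction P : set V :=
  [set v | exists2 s : seq V,
     (forall w, w \in s -> exists x y, [/\ P x, P y & w = x - y]) &
     v \in span s].

Definition has_dim P i : Prop :=
  exists2 U : {vspace V}, direction P = [set` U] & \dim U = i.

Definition lattice_basis i (b : i.-tuple V) M : Prop :=
  free b /\ M = [set x | exists c : 'I_i -> int, x = \sum_j tnth b j *~ c j].

Definition is_lattice L i : Prop := exists b : i.-tuple V, lattice_basis b L.

Definition lattice_simplex L i T : Prop :=
  exists v : i.+1.-tuple V,
    [/\ forall j, L (tnth v j), affinely_independent v & T = conv_hull v].

Definition parallelepiped i (b : i.-tuple V) : set V :=
  [set x | exists t : 'I_i -> R,
     (forall j, 0 <= t j < 1) /\ x = \sum_j t j *: tnth b j].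

(* Metric and topological notions refer to the coordinates on V given by the
   basis e, which identify V with R^d. *)
Variables (d : nat) (e : d.-tuple V).

Definition coords (x : V) : 'rV[R]_d := \row_j coord e j x.

Definition dot (x y : V) : R := \sum_j coord e j x * coord e j y.

Definition orthonormal_frame i (u : i.-tuple V) : Prop :=
  forall j k, dot (tnth u j) (tnth u k) = (j == k)%:R.

(* The i-dimensional volume of a set P spanning an i-dimensional affine space:
   the Lebesgue measure of P in the Cartesian coordinates of that space with
   origin x and orthonormal frame u.  It does not depend on x and u. *)
Definition volume i P : R :=
  xget 0 [set r | exists (x : V) (u : i.-tuple V),
    [/\ P x, orthonormal_frame u, direction P = [set` span u] &
     r = fine (@lebesgue_Rn R i
           [set c : i.-tuple R | P (x + \sum_j tnth c j *: tnth u j)])]].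

(* The determinant of a lattice of rank i: the volume of the fundamental
   parallelepiped of any one of its bases. *)
Definition lattice_det i M : R :=
  xget 0 [set r | exists2 b : i.-tuple V,
    lattice_basis b M & r = volume i (parallelepiped b)].

Definition normalized_volume L i P : R :=
  volume i P / lattice_det i (L `&` direction P).

Definition interior_in_coords P : set V :=
  [set x | (coords @` P)° (coords x)].

Definition one_interior_point_simplices L : set (set V) :=
  [set T | lattice_simplex L d T /\
           exists x, interior_in_coords T `&` L = [set x]].

End Polytopes.

(* Main.v *)
From HB Require Import structures.
Require Import Defs.
From mathcomp Require Import all_boot all_order all_algebra.
From mathcomp Require Import all_classical all_reals all_analysis.
From mathcomp Require Import perm measurable_realfun ring lra zify.
Set Implicit Arguments.
Unset Strict Implicit.
Unset Printing Implicit Defensive.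
Import Order.TTheory GRing.Theory Num.Theory.
Import numFieldNormedType.Exports.
Local Open Scope classical_set_scope.
Local Open Scope ring_scope.

(** Let [b_0 >= ... >= b_d] be the barycentric coordinates of the only interior
    lattice point [x] of a simplex [T] with vertices [v_0, ..., v_d], and let
    [G_i] be the face on [v_0, ..., v_i].  A nonzero lattice vector all of whose
    barycentric components exceed [- b_k] would yield a second interior lattice
    point.  Minkowski's theorem on linear forms produces such vectors unless
    - [b_0 ... b_(i-1) <= b_i + ... + b_d] (apply it to the vectors
      [sum_(j < i) z_j (x - v_j)], whose forms have determinant
      [1 - sum_(j < i) b_j]), whence
      [b_0 ... b_(i-1) >= (d + 1) ^ - (2 ^ i - 1)] by induction on [i];
    - the index of the lattice spanned by the edges of [G_i] in the lattice
      points of their span, which is [i!] times the normalized volume of [G_i],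
      is at most [1 / (b_0 ... b_(i-1))].
    The forms being rational, Minkowski's theorem is a pigeonhole argument on
    the quotient of [Z^n] by a sublattice, whose cardinality is read off the
    Smith normal form.  Two lattice points of [G_i] in the same class modulo the
    edges are both vertices, which bounds the number of lattice points.

    For the lower bounds, [T'] has vertices [0] and [s_j f_j], where [f] is a
    basis of [L] and [s = 2, 3, 7, 43, ...] is Sylvester's sequence; since
    [sum_(j <= d) 1 / s_j = 1 - 1 / (s_(d+1) - 1)], its only interior lattice
    point is [f_1 + ... + f_d]. *)

(** * Lebesgue measure of linear images *)

Section LebesgueRn.
Variable R : realType.
Local Notation mu := (@lebesgue_measure R).
Local Notation T := (measurableTypeR R).
Local Notation lam := (@lebesgue_Rn R).
Local Notation tcons := (@cons_tuple _ T).
Local Open Scope ereal_scope.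

Lemma lebesgue_RnS m (A : set (m.+1.-tuple T)) :
  lam A = \int[mu]_x lam [set t : m.-tuple T | A (tcons x t)].
Proof.
rewrite /=; apply: eq_integral => x _ /=; congr lebesgue_Rn.
by apply/seteqP; split=> t; rewrite /xsection /= inE.
Qed.

#[local] Arguments lebesgue_Rn : simpl never.

Lemma lebesgue_Rn_ge0 m (A : set (m.-tuple T)) : 0 <= lam A.
Proof.
elim: m A => [|m IH] A; first by rewrite /lebesgue_Rn diracE.
by rewrite lebesgue_RnS; apply: integral_ge0 => x _; exact: IH.
Qed.

Lemma measurable_cons_pair d (S : measurableType d) m
    (f : S -> T) (g : S -> m.-tuple T) (A : set (m.+1.-tuple T)) :
  measurable_fun setT f -> measurable_fun setT g -> measurable A ->
  measurable [set s | A (tcons (f s) (g s))].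
Proof.
move=> mf mg mA; rewrite -[X in measurable X]setTI.
exact: (measurable_cons mf mg).
Qed.

(* The parameter space is arbitrary so that the induction on [m] can move the
   first coordinate of the tuple into it. *)
Lemma measurable_lebesgue_Rn m d (S : measurableType d)
    (F : set (S * m.-tuple T)) : measurable F ->
  measurable_fun setT (fun s : S => lam [set t | F (s, t)] : \bar R).
Proof.
elim: m d S F => [|m IH] d S F mF.
  rewrite (_ : (fun s => _) = (fun s => (\1_[set s | F (s, [tuple])] s)%:E)).
    apply/measurable_EFinP; apply: measurable_indic.
    rewrite -[X in measurable X]setTI.
    have : measurable_fun setT (fun s : S => (s, [tuple] : 0.-tuple T)).
      by apply: measurable_fun_pair => //; exact: measurable_cst.
    by apply.
  by apply/funext => s; rewrite /lebesgue_Rn diracE indicE; congr (_%:R%:E); rewrite !inE.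
have mF' : measurable [set p : (S * T) * m.-tuple T |
    F (p.1.1, tcons p.1.2 p.2)].
  rewrite -[X in measurable X]setTI.
  have : measurable_fun setT (fun p : (S * T) * m.-tuple T =>
      (p.1.1, [the m.+1.-tuple T of p.1.2 :: p.2])).
    apply: measurable_fun_pair.
      by apply: measurableT_comp.
    apply: measurable_cons; first by apply: measurableT_comp.
    exact: measurable_snd.
  by apply.
(* By Tonelli, integrating a jointly measurable nonnegative function over one variable leaves a
   measurable function of the other. *)
have := @measurable_fun_fubini_tonelli_F _ _ S T R mu
  (fun p => lam [set t : m.-tuple T | F (p.1, tcons p.2 t)]).
rewrite /fubini_F => H.
rewrite (_ : (fun s => _) = (fun s => \int[mu]_y
    lam [set t : m.-tuple T | F (s, tcons y t)])).
  apply: H.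
    exact: (IH _ _ _ mF').
  by move=> p; exact: lebesgue_Rn_ge0.
by apply/funext => s; rewrite lebesgue_RnS.
Qed.

Lemma measurable_lebesgue_Rn_cons m (E : set (m.+1.-tuple T)) : measurable E ->
  measurable_fun setT (fun x : T => lam [set t | E (tcons x t)] : \bar R).
Proof.
move=> mE; apply: (@measurable_lebesgue_Rn m _ T
  [set p : T * m.-tuple T | E (tcons p.1 p.2)]).
exact: measurable_cons_pair.
Qed.

Lemma measurable_affine (a b : R) : measurable_fun setT (fun x : T => (a * x + b)%R : T).
Proof. by apply: measurable_funD => //; exact: measurable_funM. Qed.

(** The right-hand side, a scaled pushforward of [mu], is itself a measure; it agrees with [mu] on
    half-open intervals, which determine the Lebesgue measure. *)
Lemma lebesgue_measure_affine (a b : R) (A : set T) : a != 0%R -> measurable A ->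
  mu A = `|a|%:E * mu ((fun x => a * x + b)%R @^-1` A).
Proof.
move=> a0 mA.
pose phi (x : T) : T := (a * x + b)%R.
have mphi : measurable_fun setT phi := measurable_affine a b.
apply: (@lebesgue_measure_unique R
  (mscale (NngNum (normr_ge0 a)) (pushforward mu phi))) mA => _ [[x y] _ <-].
transitivity (`|a|%:E * mu ((fun z => a * z + b)%R @^-1` `]x, y])) => //.
move: a0; case: (ltgtP a 0%R) => // a0 _.
(* A negative slope reverses the interval, so the closed end becomes the left one. *)
- rewrite (_ : _ @^-1` _ = `[((y - b) / a)%R, ((x - b) / a)%R[%classic).
    rewrite !lebesgue_measure_itv /= !lte_fin ltr_nM2r ?invr_lt0 // ltrD2r.
    rewrite ltr0_norm //; case: ifP => _; last by rewrite mule0.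
    rewrite -!EFinB -EFinM; congr EFin; field; exact: ltr0_neq0.
  apply/seteqP; split=> z /=; rewrite !in_itv /= ler_ndivrMr // ltr_ndivlMr //;
  by rewrite ltrBlDr lerBrDr [(z * a)%R]mulrC andbC.
- rewrite (_ : _ @^-1` _ = `]((x - b) / a)%R, ((y - b) / a)%R]%classic).
    rewrite !lebesgue_measure_itv /= !lte_fin ltr_pM2r ?invr_gt0 // ltrD2r.
    rewrite gtr0_norm //; case: ifP => _; last by rewrite mule0.
    rewrite -!EFinB -EFinM; congr EFin; field; exact: lt0r_neq0.
  apply/seteqP; split=> z /=; rewrite !in_itv /= ltr_pdivrMr // ler_pdivlMr //;
  by rewrite ltrBlDr lerBrDr [(z * a)%R]mulrC.
Qed.

Lemma integral_affine (a b : R) (f : T -> \bar R) : a != 0%R ->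
  measurable_fun setT f -> (forall x, 0 <= f x) ->
  \int[mu]_x f (a * x + b)%R = (`|a|^-1)%:E * \int[mu]_x f x.
Proof.
move=> a0 mf f0.
pose phi (x : T) : T := (a * x + b)%R.
have mphi : measurable_fun setT phi := measurable_affine a b.
pose nu : {measure set T -> \bar R} :=
  mscale (NngNum (normr_ge0 a)) (pushforward mu phi).
rewrite [in RHS](eq_measure_integral (nu mphi)); last first.
  by move=> A mA _; exact: lebesgue_measure_affine.
rewrite /nu ge0_integral_mscale //.
transitivity (`|a|^-1%:E * (`|a|%:E * \int[pushforward mu phi]_x f x)); last first.
  by [].
rewrite (@ge0_integral_pushforward _ _ _ _ R phi mphi _ setT f measurableT mf) //.
by rewrite muleA -EFinM /= mulVf ?normr_eq0 // mul1e.
Qed.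

(** Tuples carry the measurable structure and row vectors the matrix algebra; [rowt] and [trow] pass
    between the two. *)
Definition rowt n (c : n.-tuple T) : 'rV[R]_n := \row_j tnth c j.
Definition trow n (r : 'rV[R]_n) : n.-tuple T := [tuple r ord0 j | j < n].

Lemma trowK n : cancel (@trow n) (@rowt n).
Proof. by move=> r; apply/rowP => j; rewrite mxE tnth_mktuple. Qed.

Lemma rowtK n : cancel (@rowt n) (@trow n).
Proof. by move=> c; apply: eq_from_tnth => j; rewrite tnth_mktuple mxE. Qed.

Lemma rowt_cons n x (t : n.-tuple T) :
  rowt (tcons x t) = row_mx (x%:M : 'M[R]_1) (rowt t) :> 'rV[R]_(1 + n).
Proof.
apply/rowP => j; rewrite [LHS]mxE; case: (split_ordP j) => k ->.
  rewrite row_mxEl mxE (ord1 k) eqxx mulr1n.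
  rewrite -[RHS](tnth0 x t); apply: (congr1 (tnth (tcons x t))); exact: val_inj.
rewrite row_mxEr mxE -[RHS](tnthS x t).
apply: (congr1 (tnth (tcons x t))); exact: val_inj.
Qed.

Lemma trow_cons n (x : 'rV[R]_1) (r : 'rV[R]_n) :
  trow (row_mx x r : 'rV[R]_(1 + n)) = tcons (x ord0 ord0) (trow r).
Proof.
by rewrite -[RHS]rowtK rowt_cons trowK -mx11_scalar.
Qed.

Lemma measurable_mulmx n p (A : 'M[R]_(n, p)) v :
  measurable_fun setT (fun c : n.-tuple T => trow (rowt c *m A + v)).
Proof.
apply/measurable_fun_tnthP => j.
rewrite (_ : _ \o _ = (fun c : n.-tuple T => (\sum_k tnth c k * A k j) + v ord0 j)%R).
  apply: measurable_funD => //; apply: measurable_sum => k.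
  by apply: measurable_funM => //; exact: measurable_tnth.
apply/funext => c /=; rewrite tnth_mktuple !mxE; congr (_ + _)%R.
by apply: eq_bigr => k _; rewrite mxE.
Qed.

Lemma measurable_preimage_mulmx n p (A : 'M[R]_(n, p)) v (E : set (p.-tuple T)) :
  measurable E -> measurable [set c : n.-tuple T | E (trow (rowt c *m A + v))].
Proof. by move=> mE; rewrite -[X in measurable X]setTI; exact: measurable_mulmx. Qed.

Lemma measurable_section m (E : set (m.+1.-tuple T)) x : measurable E ->
  measurable [set t | E (tcons x t)].
Proof. by move=> mE; apply: measurable_cons_pair. Qed.

(** Slice along the first coordinate: the slices are handled by induction, and the outer integral is
    invariant under a shift of its variable. *)
Lemma lebesgue_Rn_translate n (v : 'rV[R]_n) (E : set (n.-tuple T)) : measurable E ->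
  lam [set c | E (trow (rowt c + v))] = lam E.
Proof.
elim: n v E => [|n IH] v E mE.
  by congr (lam _); apply/funext => c /=; rewrite [trow _]tuple0 [in RHS](tuple0 c).
rewrite -(@hsubmxK _ 1 1 n v) in E mE *.
set v1 := lsubmx _; set v2 := rsubmx _.
rewrite !lebesgue_RnS.
pose f (x : T) := lam [set t | E (tcons x t)].
transitivity (\int[mu]_x f (1 * x + v1 ord0 ord0)%R).
  apply: eq_integral => x _.
  rewrite -[RHS](IH v2); last exact: measurable_section.
  congr (lam _); apply/funext => t /=; congr (E _).
  rewrite [X in trow X](_ : _ =
    row_mx (x%:M + v1) (rowt t + v2) :> 'rV[R]_(1 + n))%R; last first.
    by rewrite rowt_cons; exact: add_row_mx.
  by rewrite trow_cons !mxE eqxx mulr1n mul1r.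
rewrite (@integral_affine 1 (v1 ord0 ord0)) //.
- by rewrite normr1 invr1 mul1e.
- exact: measurable_lebesgue_Rn_cons.
- by move=> x; exact: lebesgue_Rn_ge0.
Qed.

(** The set measured on the left is the preimage of [E] under right multiplication by [A], whence
    the inverse of the determinant. In this form the property composes and only preimages have to be
    measurable. *)
Definition scales_lebesgue n (A : 'M[R]_n) := forall E : set (n.-tuple T), measurable E ->
  lam [set c | E (trow (rowt c *m A))] = (`|\det A|^-1)%:E * lam E.

Lemma scales_lebesgueM n (A B : 'M[R]_n) :
  scales_lebesgue A -> scales_lebesgue B -> scales_lebesgue (A *m B).
Proof.
move=> sA sB E mE.
have mE' : measurable [set c | E (trow (rowt c *m B))].
  have := measurable_preimage_mulmx B 0%R mE.
  by congr measurable; apply/seteqP; split=> c /=; rewrite addr0.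
rewrite det_mulmx normrM invfM EFinM -muleA -sB // -sA //; congr (lam _).
by apply/seteqP; split=> c /=; rewrite trowK mulmxA.
Qed.

(** Up to a translation by [x *: b], the slice of the preimage at [x] is the slice of [E] at [a x];
    what remains is a rescaling of the outer integral. *)
Lemma scales_lebesgue_shear n (a : 'M[R]_1) (b : 'rV[R]_n) : a ord0 ord0 != 0%R ->
  scales_lebesgue (block_mx a b 0 1%:M : 'M[R]_(1 + n)).
Proof.
move=> a0 E mE; rewrite !lebesgue_RnS.
rewrite det_ublock det1 mulr1 det_mx11 -(@integral_affine _ 0%R) //; last 2 first.
- exact: measurable_lebesgue_Rn_cons.
- by move=> x; exact: lebesgue_Rn_ge0.
apply: eq_integral => x _.
rewrite -[RHS](@lebesgue_Rn_translate _ (x *: b)%R); last exact: measurable_section.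
congr (lam _); apply/funext => t /=; congr (E _).
rewrite rowt_cons mul_row_block mulmx0 mulmx1 addr0 trow_cons mul_scalar_mx mxE addr0.
by rewrite mulrC mul_scalar_mx addrC.
Qed.

Lemma scales_lebesgue_block n (D : 'M[R]_n) : scales_lebesgue D ->
  scales_lebesgue (block_mx 1%:M 0 0 D : 'M[R]_(1 + n)).
Proof.
move=> sD E mE; rewrite !lebesgue_RnS.
rewrite det_ublock det1 mul1r -ge0_integralZl //; last 2 first.
- exact: measurable_lebesgue_Rn_cons.
- by move=> x _; exact: lebesgue_Rn_ge0.
apply: eq_integral => x _; rewrite -[RHS]sD; last exact: measurable_section.
congr (lam _); apply/funext => t /=; congr (E _).
by rewrite rowt_cons mul_row_block !mulmx0 mulmx1 addr0 add0r trow_cons mxE eqxx mulr1n.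
Qed.

Lemma scales_lebesgue_ublock n (A : 'M[R]_(1 + n)) :
  (forall D : 'M[R]_n, D \in unitmx -> scales_lebesgue D) ->
  A \in unitmx -> dlsubmx A = 0%R -> scales_lebesgue A.
Proof.
move=> IH uA A0; rewrite -(submxK A) A0 in uA *.
move: uA; rewrite unitmxE det_ublock det_mx11 unitrM unitfE -unitmxE.
move=> /andP[a0 uD].
rewrite (_ : block_mx _ _ _ _ =
  block_mx 1%:M 0 0 (drsubmx A) *m block_mx (ulsubmx A) (ursubmx A) 0 1%:M)%R.
  apply: scales_lebesgueM; first exact/scales_lebesgue_block/IH.
  exact: scales_lebesgue_shear.
by rewrite mulmx_block !mul1mx !mul0mx !mulmx0 mulmx1 !addr0 !add0r.
Qed.

(** Swapping the first two coordinates exchanges the order of two integrations of a nonnegative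
    function, so this is Tonelli's theorem. *)
Lemma scales_lebesgue_swap n :
  scales_lebesgue (tperm_mx ord0 (lift ord0 ord0) : 'M[R]_n.+2).
Proof.
move=> E mE.
have swapE x y (t : n.-tuple T) :
    trow (rowt (tcons x (tcons y t)) *m tperm_mx ord0 (lift ord0 ord0)) =
    tcons y (tcons x t).
  rewrite -xcolE; apply: eq_from_tnth => j; rewrite tnth_mktuple !mxE.
  case: (unliftP ord0 j) => [k ->|->]; last by rewrite tpermL tnthS !tnth0.
  case: (unliftP ord0 k) => [l ->|->]; first by rewrite tpermD // !tnthS.
  by rewrite tpermR tnthS !tnth0.
rewrite /tperm_mx det_perm odd_tperm /= expr1 normrN1 invr1 mul1e.
rewrite !lebesgue_RnS.
pose f (p : T * T) := lam [set t | E (tcons p.1 (tcons p.2 t))].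
have mf : measurable_fun setT f.
  apply: (measurable_lebesgue_Rn
    (F := [set q : (T * T) * n.-tuple T | E (tcons q.1.1 (tcons q.1.2 q.2))])).
  apply: measurable_cons_pair => //; first exact: measurableT_comp.
  by apply: measurable_cons; [exact: measurableT_comp | exact: measurable_snd].
rewrite (_ : (\int[mu]_x _) = \int[mu]_x \int[mu]_y f (y, x)); last first.
  apply: eq_integral => x _; rewrite lebesgue_RnS; apply: eq_integral => y _.
  congr (lam _); apply/funext => t /=; congr (E _); exact: swapE.
rewrite -(@fubini_tonelli _ _ T T R mu mu f mf); last first.
  by move=> p; exact: lebesgue_Rn_ge0.
by apply: eq_integral => x _; rewrite lebesgue_RnS.
Qed.

(* The block upper triangular matrices and the swap of the first two coordinates
   generate the general linear group: if the first column of [A] is not a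
   multiple of the first basis vector, a shear clears [A 0 0], a change of basis
   on the other coordinates leaves a single entry below it, and the swap moves
   this entry to the corner. *)
Lemma unitmx_scales_lebesgue n (A : 'M[R]_n) : A \in unitmx -> scales_lebesgue A.
Proof.
elim: n A => [|n IH] A uA.
  move=> E mE; rewrite det_mx00 normr1 invr1 mul1e; congr (lam _).
  by apply/funext => c /=; rewrite [trow _]tuple0 [in RHS](tuple0 c).
have [c0|c0] := eqVneq (dlsubmx (A : 'M[R]_(1 + n))) 0%R.
  exact: scales_lebesgue_ublock.
case: n => [|n] in IH A uA c0 *; first by rewrite [dlsubmx _]flatmx0 eqxx in c0.
set c : 'cV_n.+1 := dlsubmx _ in c0.
pose a := ulsubmx (A : 'M[R]_(1 + n.+1)); pose b := ursubmx (A : 'M[R]_(1 + n.+1)).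
pose D := drsubmx (A : 'M[R]_(1 + n.+1)).
have rc : \rank c = 1%N.
  by apply/eqP; rewrite eqn_leq rank_leq_col lt0n mxrank_eq0.
have cK : pinvmx c *m c = 1%:M by apply: mulVpmx; rewrite /row_full rc.
(* Since [r *m c = a], subtracting [r] times the lower rows from the top row clears the corner. *)
pose r := a *m pinvmx c.
(* In this basis the column [c], of rank one, keeps only its first entry. *)
pose K := col_ebase c.
pose A2 : 'M[R]_(1 + n.+1) := block_mx 0 (b - r *m D) (invmx K *m c) (invmx K *m D).
have uK : K \in unitmx := col_ebase_unit c.
have defA : A = block_mx 1%:M r 0 1%:M *m
    (block_mx 1%:M 0 0 K *m A2) :> 'M[R]_(1 + n.+1).
  rewrite /A2 !mulmx_block !mul1mx !mul0mx ?mulmx0 !addr0 !add0r !mulKVmx //.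
  rewrite /r -mulmxA cK mulmx1. by rewrite addrNK submxK.
pose S : 'M[R]_n.+2 := tperm_mx ord0 (lift ord0 ord0).
have SS : S *m S = 1%:M.
  by rewrite /S /tperm_mx -perm_mxM tperm2 perm_mx1.
have defA2 : A2 = S *m (S *m A2) by rewrite mulmxA SS mul1mx.
have uA2 : A2 \in unitmx.
  move: uA; rewrite [A]defA unitmx_mul unitmx_mul => /and3P[//].
rewrite [A]defA; apply: scales_lebesgueM.
  apply: (@scales_lebesgue_shear n.+1 1%:M); by rewrite mxE oner_neq0.
apply: scales_lebesgueM; first exact/scales_lebesgue_block/IH.
rewrite defA2; apply: scales_lebesgueM; first exact: scales_lebesgue_swap.
apply: scales_lebesgue_ublock => //.
  by rewrite unitmx_mul uA2 andbT unitmxE /S det_perm unitrX // unitrN unitr1.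
have cE : invmx K *m c = pid_mx 1 *m row_ebase c.
  by rewrite -[in LHS](mulmx_ebase c) -/K rc -mulmxA mulKmx.
apply/colP => i; rewrite /S -xrowE 3!mxE [RHS]mxE.
case: (unliftP ord0 i) => [k ->|->].
  rewrite tpermD //.
  transitivity ((invmx K *m c) (lift ord0 k) ord0); first exact: block_mxEdl.
  by rewrite cE mxE big1 // => j _; rewrite mxE /= andbF mul0r.
have -> : rshift 1 ord0 = lift ord0 ord0 :> 'I_n.+2 by exact: val_inj.
rewrite tpermR; have -> : ord0 = lshift n.+1 (ord0 : 'I_1) :> 'I_(1 + n.+1) by exact: val_inj.
by transitivity ((0%R : 'M[R]_1) ord0 ord0); [exact: block_mxEul | rewrite mxE].
Qed.

(** * Measures of the unit cube and of the corner simplex *)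

Lemma integral_deriv_poly (p : {poly R}) (a b : R) : (a < b)%R ->
  \int[mu]_(x in `[a, b]) (p^`().[x])%:E = (p.[b] - p.[a])%:E.
Proof.
move=> ab; rewrite (@continuous_FTC2 _ _ (horner p)) //.
- by apply: continuous_subspaceT => x; exact: continuous_horner.
- split=> [x _||]; first exact: derivable_horner.
    exact/cvg_at_right_filter/continuous_horner.
  exact/cvg_at_left_filter/continuous_horner.
- by move=> x _; rewrite -derivE.
Qed.

Lemma lebesgue_Rn_set0 n : lam (set0 : set (n.-tuple T)) = 0.
Proof.
elim: n => [|n IH]; first by rewrite /lebesgue_Rn diracE in_set0.
by rewrite lebesgue_RnS integral0_eq // => x _; exact: IH.
Qed.

Lemma measurable_forall_tnth n (B : set T) : measurable B ->
  measurable [set c : n.-tuple T | forall j, B (tnth c j)].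
Proof.
move=> mB.
rewrite (_ : [set c | _] = \bigcap_(j in [set: 'I_n]) [set c : n.-tuple T | B (tnth c j)]).
  apply: fin_bigcap_measurable => [|j _]; first exact: finite_finset.
  by rewrite -[X in measurable X]setTI; exact: measurable_tnth.
by apply/seteqP; split=> c /= H j; [move=> _|]; exact: H.
Qed.

Definition unit_cube n : set (n.-tuple T) := [set c | forall j, (0 <= tnth c j < 1)%R].

Lemma measurable_unit_cube n : measurable (@unit_cube n).
Proof.
have := @measurable_forall_tnth n `[0%R, 1%R[ (measurable_itv _).
by congr measurable; apply/seteqP; split=> c /= H j; move: (H j); rewrite in_itv.
Qed.

Lemma lebesgue_Rn_cube n : lam (@unit_cube n) = 1.
Proof.
elim: n => [|n IH].
  by rewrite /lebesgue_Rn diracE mem_set //= => -[].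
rewrite lebesgue_RnS.
transitivity (\int[mu]_x (\1_(`[0%R, 1%R[%classic : set T) x)%:E).
  apply: eq_integral => x _; rewrite indicE.
  case: (boolP (x \in (`[0%R, 1%R[%classic : set T))) => [|nx].
    rewrite inE /= in_itv /= => x01; rewrite -IH; congr (lam _).
    apply/seteqP; split=> t /= H j; first by have := H (lift ord0 j); rewrite tnthS.
    by case: (unliftP ord0 j) => [k ->|->]; rewrite ?tnthS ?tnth0.
  rewrite -[RHS](lebesgue_Rn_set0 n); congr (lam _); apply/seteqP; split=> // t /= H.
  by move/negP: nx; apply; rewrite inE /= in_itv; have := H ord0; rewrite tnth0.
rewrite integral_indic // setIT.
by rewrite [LHS]lebesgue_measure_itv /= lte_fin ltr01 -EFinB subr0.
Qed.

(** The size [r] is a parameter because the slices of such a simplex are simplices of smaller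
    size. *)
Definition corner_simplex n (r : R) : set (n.-tuple T) :=
  [set c | (forall j, 0 <= tnth c j)%R /\ (\sum_j tnth c j <= r)%R].

Lemma measurable_corner_simplex n r : measurable (@corner_simplex n r).
Proof.
apply: measurableI.
  have := @measurable_forall_tnth n `[0%R, +oo[ (measurable_itv _).
  by congr measurable; apply/seteqP; split=> c /= H j; move: (H j); rewrite in_itv /= andbT.
have mS : measurable_fun setT (fun c : n.-tuple T => \sum_j tnth c j)%R.
  by apply: measurable_sum => j; exact: measurable_tnth.
have := mS measurableT `]-oo, r]%classic (measurable_itv _).
by rewrite setTI; congr measurable; apply/seteqP; split=> c /=; rewrite in_itv.
Qed.

(** The slice at [x] in [[0, r]] is the corner simplex of size [r - x], and the other slices are
    empty; it remains to integrate [(r - x)^n / n!]. *)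
Lemma lebesgue_Rn_simplex n (r : R) : (0 <= r)%R ->
  lam (@corner_simplex n r) = (r ^+ n / n`!%:R)%:E.
Proof.
elim: n r => [|n IH] r r0.
  rewrite /lebesgue_Rn diracE mem_set //= ?fact0 ?expr0 ?divr1 //.
  by split=> [[]//|]; rewrite big_ord0.
rewrite lebesgue_RnS.
transitivity (\int[mu]_(x in `[0%R, r]) ((r - x) ^+ n / n`!%:R)%:E).
  rewrite [RHS]integral_mkcond; apply: eq_integral => x _; rewrite patchE.
  have consE (t : n.-tuple T) : corner_simplex r (tcons x t) <->
      (0 <= x)%R /\ corner_simplex (r - x) t.
    have sumE : (\sum_j tnth (tcons x t) j = x + \sum_j tnth t j)%R.
      by rewrite big_ord_recl tnth0; congr (_ + _)%R; apply: eq_bigr => j _; rewrite tnthS.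
    rewrite /corner_simplex /= sumE.
    split=> [[H xr]|[x0 [H xr]]].
      split; first by have := H ord0; rewrite tnth0.
      split=> [j|]; first by have := H (lift ord0 j); rewrite tnthS.
      by rewrite lerBrDl.
    split=> [j|]; last by rewrite -lerBrDl.
    by case: (unliftP ord0 j) => [k ->|->]; rewrite ?tnthS ?tnth0.
  case: (boolP (x \in (`[0%R, r]%classic : set T))) => [|nx].
    rewrite inE /= in_itv /= => /andP[x0 xr]; rewrite -IH ?subr_ge0 //; congr (lam _).
    by apply/seteqP; split=> t /=; [case/consE | move=> H; apply/consE].
  rewrite -[RHS](lebesgue_Rn_set0 n); congr (lam _); apply/seteqP; split=> // t /=.
  move=> /consE[x0 [H Hr]]; move/negP: nx; apply; rewrite inE /= in_itv /= x0 /=.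
  by rewrite -subr_ge0; apply: le_trans Hr; apply: sumr_ge0.
(* The fundamental theorem of calculus is applied on a nondegenerate interval, so [r = 0] is treated
   apart. *)
move: r0; rewrite le_eqVlt => /predU1P[<-|r0].
  by rewrite set_itv1 integral_set1 expr0n mul0r.
pose p : {poly R} := (- (n.+1)`!%:R^-1 *: (r%:P - 'X) ^+ n.+1)%R.
transitivity (p.[r] - p.[0])%:E.
  rewrite -(integral_deriv_poly p r0); apply: eq_integral => x _; congr EFin.
  rewrite /p derivZ deriv_exp derivB derivC derivX sub0r /=.
  rewrite hornerZ hornerMn hornerM hornerN !hornerE.
  rewrite factS natrM; by field; rewrite !pnatr_eq0 -lt0n fact_gt0 addrC natr1 pnatr_eq0.
congr EFin.
rewrite /p !hornerE subrr expr0n mulr0 sub0r.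
by rewrite mulNr opprK subr0 mulrC.
Qed.

End LebesgueRn.

(** * Minkowski's theorem on linear forms *)

Lemma card_dffun_ord n (s : 'I_n -> nat) :
  #|{dffun forall j, 'I_(s j)}| = (\prod_j s j)%N.
Proof.
rewrite card_dep_ffun foldrE big_image; apply: eq_bigr => j _; exact: card_ord.
Qed.

Lemma absz_unit_det n (U : 'M[int]_n) : U \in unitmx -> absz (\det U) = 1%N.
Proof. by rewrite unitmxE => /orP[/eqP->|/eqP->]. Qed.

(** In Smith form [B = L *m D *m U], a row [y] is an integer combination of the rows of [B] exactly
    when the entries of [y *m invmx U] are divisible by the diagonal entries of [D]. The residues of
    these entries label the classes, and the number of labels is [|\det B|]. *)
Lemma residue_class n (B : 'M[int]_n) : \det B != 0 ->
  exists (I : finType) (phi : 'rV[int]_n -> I), #|I| = absz (\det B) /\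
    forall y y', phi y = phi y' -> exists z, y - y' = z *m B.
Proof.
move=> nzB; have [L uL [U uU [d _ defB]]] := int_Smith_normal_form B.
set D := \matrix_(i, j) _ in defB.
pose e (j : 'I_n) := d`_j.
have defD : D = diag_mx (\row_j e j).
  by apply/matrixP => i j; rewrite !mxE; case: eqP => [/val_inj ->|/eqP]; rewrite ?eqxx // => /negPf; rewrite -val_eqE /= => ->.
have detB : absz (\det B) = (\prod_(j < n) absz (e j))%N.
  rewrite defB !det_mulmx !abszM (absz_unit_det uL) (absz_unit_det uU) mul1n muln1 defD det_diag.
  rewrite (big_morph absz abszM (erefl : absz 1 = 1%N)).
  by apply: eq_bigr => j _; rewrite mxE.
have nzd (j : 'I_n) : e j != 0.
  apply: contraNneq nzB => dj0; rewrite -absz_eq0 detB; apply/eqP.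
  by rewrite (bigD1 j) //= dj0 mul0n.
have ltd (y : 'rV[int]_n) (j : 'I_n) :
    (absz ((y *m invmx U) ord0 j %% e j)%Z < absz (e j))%N.
  have := ltz_mod ((y *m invmx U) ord0 j) (nzd j).
  have := modz_ge0 ((y *m invmx U) ord0 j) (nzd j).
  by lia.
exists {dffun forall j : 'I_n, 'I_(absz (e j))}, (fun y => [ffun j => Ordinal (ltd y j)]).
split=> [|y y' /ffunP eqyy]; first by rewrite detB; exact: card_dffun_ord.
have dvd j : (e j %| ((y - y') *m invmx U) ord0 j)%Z.
  have /(congr1 val) := eqyy j; rewrite !ffunE /= => eqj.
  have -> : ((y - y') *m invmx U) ord0 j =
      (y *m invmx U) ord0 j - (y' *m invmx U) ord0 j.
    by rewrite mulmxBl [LHS]mxE [X in _ + X]mxE.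
  rewrite -eqz_mod_dvd.
  have := modz_ge0 ((y *m invmx U) ord0 j) (nzd j).
  have := modz_ge0 ((y' *m invmx U) ord0 j) (nzd j).
  by move: eqj; lia.
exists ((\row_j (((y - y') *m invmx U) ord0 j %/ e j)%Z) *m invmx L).
rewrite defB !mulmxA mulmxKV // -[LHS](mulmxKV uU); congr (_ *m _).
apply/rowP => j; rewrite defD mul_mx_diag [RHS]mxE [X in _ = X * _]mxE [X in _ = _ * X]mxE.
by rewrite divzK // dvd.
Qed.

(** The box of integer points with [0 <= f_j < ceil (r_j)] has at least [\prod_j r_j], hence more
    than [|\det C|], points. Two of them are congruent modulo the rows of [C]; the entries of their
    difference are at most [ceil (r_j) - 1 < r_j]. *)
Lemma minkowski_linear_forms (R : realType) n (C : 'M[int]_n) (r : 'I_n -> R) :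
  \det C != 0 -> (forall j, 0 < r j) -> `|\det C|%:~R < \prod_j r j ->
  exists2 z : 'rV[int]_n, z != 0 & forall j, `|(z *m C) ord0 j|%:~R < r j.
Proof.
move=> nzC r0 ltC; have [I [phi [cardI phiP]]] := residue_class nzC.
pose s j := absz (Num.ceil (r j)).
have sE j : (s j)%:R = (Num.ceil (r j))%:~R :> R.
  rewrite /s natr_absz ger0_norm //.
  by rewrite -(ler_int R) (le_trans (ltW (r0 j))) // ceil_ge.
pose F := {dffun forall j, 'I_(s j)}.
pose g (f : F) : 'rV[int]_n := \row_j (f j : nat)%:Z.
have /injectivePn[f [f' neq eqf]] : ~~ injectiveb (phi \o g).
  apply/negP => /injectiveP inj; move: ltC; apply/negP; rewrite -leNgt.
  have := leq_card _ inj; rewrite card_dffun_ord cardI -(ler_nat R).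
  rewrite natr_absz; apply: le_trans; rewrite natr_prod; apply: ler_prod => j _.
  by rewrite sE ltW //= ceil_ge.
have [z defz] := phiP _ _ eqf.
exists z; last move=> j.
  apply: contraNneq neq => z0; move: defz; rewrite z0 mul0mx => /eqP.
  rewrite subr_eq0 => /eqP/rowP eqg; apply/eqP/ffunP => j.
  by apply: val_inj; have := eqg j; rewrite !mxE => -[].
rewrite -defz !mxE; have := ltn_ord (f j); have := ltn_ord (f' j) => lf' lf.
have : (`|(f j : nat)%:Z - (f' j : nat)%:Z| <= Num.ceil (r j) - 1).
  have : (s j)%:Z = Num.ceil (r j) by apply: (@intr_inj R); rewrite -sE.
  lia.
rewrite -(ler_int R) => /le_lt_trans; apply; exact: ceilB1_lt.
Qed.

(** The block matrix with diagonal blocks 1 and off-diagonal blocks [v], [u] is factored in two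
    ways, and the determinants are compared. *)
Lemma det_1_sub_rank1 (K : comNzRingType) n (u : 'cV[K]_n) (v : 'rV[K]_n) :
  \det (1%:M - u *m v) = 1 - (v *m u) ord0 ord0.
Proof.
have E1 : block_mx 1%:M 0 u 1%:M *m block_mx 1%:M v 0 (1%:M - u *m v) =
    block_mx 1%:M v u 1%:M :> 'M[K]_(1 + n).
  by rewrite mulmx_block !mul1mx !mul0mx ?mulmx1 ?mulmx0 ?addr0 addrC subrK.
have E2 : block_mx (1%:M - v *m u) v 0 1%:M *m block_mx 1%:M 0 u 1%:M =
    block_mx 1%:M v u 1%:M :> 'M[K]_(1 + n).
  by rewrite mulmx_block !mul1mx !mul0mx ?mulmx1 ?mulmx0 ?add0r subrK.
have := congr1 determinant E1; rewrite -E2 !det_mulmx !det_lblock !det_ublock !det1.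
by rewrite !mul1r !mulr1 => ->; rewrite det_mx11 !mxE eqxx.
Qed.

(** * Volumes of simplices and parallelepipeds *)

Section Combinations.
Variables (R : realType) (V : vectType R).

Definition lincomb n (w : n.-tuple V) (t : 'rV[R]_n) : V :=
  \sum_j t ord0 j *: tnth w j.

Lemma lincombD n (w : n.-tuple V) t t' :
  lincomb w (t + t') = lincomb w t + lincomb w t'.
Proof. by rewrite -big_split; apply: eq_bigr => j _; rewrite mxE scalerDl. Qed.

Lemma lincombZ n (w : n.-tuple V) a t : lincomb w (a *: t) = a *: lincomb w t.
Proof. by rewrite scaler_sumr; apply: eq_bigr => j _; rewrite mxE scalerA. Qed.

Lemma lincombN n (w : n.-tuple V) t : lincomb w (- t) = - lincomb w t.
Proof. by rewrite -scaleN1r lincombZ scaleN1r. Qed.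

Lemma lincombB n (w : n.-tuple V) t t' :
  lincomb w (t - t') = lincomb w t - lincomb w t'.
Proof. by rewrite lincombD lincombN. Qed.

Lemma lincomb0 n (w : n.-tuple V) : lincomb w 0 = 0.
Proof. by rewrite -(scale0r 0) lincombZ scale0r. Qed.

Lemma lincomb_delta n (w : n.-tuple V) j : lincomb w (delta_mx ord0 j) = tnth w j.
Proof.
rewrite /lincomb (bigD1 j) //= mxE !eqxx scale1r big1 ?addr0 // => k /negPf kj.
by rewrite mxE eqxx kj scale0r.
Qed.

Lemma lincomb_mul n m (w' : m.-tuple V) (w : n.-tuple V) (A : 'M[R]_(m, n)) t :
  (forall i, tnth w' i = lincomb w (row i A)) ->
  lincomb w' t = lincomb w (t *m A).
Proof.
move=> wA; rewrite /lincomb; under eq_bigr do rewrite wA scaler_sumr.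
rewrite exchange_big /=; apply: eq_bigr => k _; rewrite mxE scaler_suml.
by apply: eq_bigr => j _; rewrite mxE scalerA.
Qed.

Lemma span_lincomb n (w : n.-tuple V) x :
  (x \in <<w>>%VS) <-> exists t, x = lincomb w t.
Proof.
split=> [xw|[t ->]].
  exists (\row_j coord w j x); rewrite [LHS](coord_span xw).
  by apply: eq_bigr => j _; rewrite mxE (tnth_nth 0).
by apply: rpred_sum => j _; apply/rpredZ/memv_span/mem_tnth.
Qed.

Lemma free_lincomb_inj n (w : n.-tuple V) : free w -> injective (lincomb w).
Proof.
move=> /freeP fw t t' eqt; apply/rowP => j; apply/eqP; rewrite -subr_eq0.
rewrite -[X in X == _](_ : (t - t') ord0 j = _); last by rewrite !mxE.
apply/eqP; apply: (fw (fun j => (t - t') ord0 j)).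
under eq_bigr do rewrite -tnth_nth.
by rewrite -/(lincomb w (t - t')) lincombB eqt subrr.
Qed.

Lemma lincomb_inj_free n (w : n.-tuple V) :
  (forall t, lincomb w t = 0 -> t = 0) -> free w.
Proof.
move=> inj; apply/freeP => k H j.
have /rowP : (\row_j k j) = 0 :> 'rV[R]_n.
  by apply: inj; rewrite -[RHS]H; apply: eq_bigr => i _; rewrite mxE (tnth_nth 0).
by move=> /(_ j); rewrite !mxE.
Qed.

Lemma lincomb_span_matrix n m (w : n.-tuple V) (w' : m.-tuple V) :
  (forall i, tnth w' i \in <<w>>%VS) ->
  exists A : 'M[R]_(m, n), forall i, tnth w' i = lincomb w (row i A).
Proof.
move=> Hw; have /choice[f fP] : forall i, exists t, tnth w' i = lincomb w t.
  by move=> i; apply/span_lincomb.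
by exists (\matrix_i f i) => i; rewrite rowK.
Qed.

Lemma free_unitmx n (w w' : n.-tuple V) (A : 'M[R]_n) :
  (forall i, tnth w' i = lincomb w (row i A)) -> free w' -> A \in unitmx.
Proof.
move=> wA fw'; rewrite -row_free_unit; apply/inj_row_free => t tA.
by apply: (free_lincomb_inj fw'); rewrite lincomb0 (lincomb_mul _ wA) tA lincomb0.
Qed.

Lemma unitmx_free n (w w' : n.-tuple V) (A : 'M[R]_n) :
  (forall i, tnth w' i = lincomb w (row i A)) -> free w -> A \in unitmx -> free w'.
Proof.
move=> wA fw uA; apply: lincomb_inj_free => t; rewrite (lincomb_mul _ wA) => H.
have : t *m A = 0 by apply: (free_lincomb_inj fw); rewrite H lincomb0.
by move=> /(congr1 (mulmx^~ (invmx A))); rewrite mulmxK // mul0mx.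
Qed.

End Combinations.

(** * Scalar products, Gram determinants and volumes of affine images *)

Section Volume.
Variables (R : realType) (V : vectType R) (d : nat) (e : d.-tuple V).
Hypothesis he : basis_of {:V} e.
Local Notation dot := (dot e).

Lemma dotC x y : dot x y = dot y x.
Proof. by apply: eq_bigr => j _; rewrite mulrC. Qed.

Lemma dotDl x y z : dot (x + y) z = dot x z + dot y z.
Proof. by rewrite -big_split; apply: eq_bigr => j _; rewrite linearD mulrDl. Qed.

Lemma dotZl a x z : dot (a *: x) z = a * dot x z.
Proof. by rewrite mulr_sumr; apply: eq_bigr => j _; rewrite linearZ mulrA. Qed.

Lemma dot_suml n (f : 'I_n -> V) z : dot (\sum_j f j) z = \sum_j dot (f j) z.
Proof.
rewrite (big_morph (fun x => dot x z) (fun x y => dotDl x y z) (_ : dot 0 z = 0)) //.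
by rewrite -(scale0r 0) dotZl mul0r.
Qed.

Lemma dot_lincombl n (w : n.-tuple V) t z :
  dot (lincomb w t) z = \sum_j t ord0 j * dot (tnth w j) z.
Proof. by rewrite dot_suml; apply: eq_bigr => j _; rewrite dotZl. Qed.

Lemma dot_lincombr n (w : n.-tuple V) t z :
  dot z (lincomb w t) = \sum_j t ord0 j * dot z (tnth w j).
Proof. by rewrite dotC dot_lincombl; apply: eq_bigr => j _; rewrite dotC. Qed.

Lemma dot_gt0 x : x != 0 -> 0 < dot x x.
Proof.
move=> x0; rewrite lt_neqAle sumr_ge0 ?andbT; last by move=> j _; rewrite -expr2 sqr_ge0.
apply: contraNneq x0 => /esym H; apply/eqP.
have {}H j : coord e j x = 0.
  apply/eqP; rewrite -sqrf_eq0 expr2; apply/eqP; move: j isT.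
  by apply/psumr_eq0P => // j _; rewrite -expr2 sqr_ge0.
rewrite (coord_span (_ : x \in <<e>>%VS)); last by rewrite (span_basis he) memvf.
by apply: big1 => j _; rewrite H scale0r.
Qed.

Lemma orthonormal_coord n (u : n.-tuple V) t j : orthonormal_frame e u ->
  dot (lincomb u t) (tnth u j) = t ord0 j.
Proof.
move=> ou; rewrite dot_lincombl (bigD1 j) //= ou eqxx mulr1 big1 ?addr0 // => k.
by move=> /negPf kj; rewrite ou kj mulr0.
Qed.

Lemma orthonormal_free n (u : n.-tuple V) : orthonormal_frame e u -> free u.
Proof.
move=> ou; apply: lincomb_inj_free => t H; apply/rowP => j.
rewrite -(orthonormal_coord t j ou) H mxE.
by rewrite -(scale0r 0) dotZl mul0r.
Qed.

(** Gram-Schmidt: the first vector is reduced by its projection on the frame found for the others,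
    then normalized. *)
Lemma orthonormal_basis n (w : n.-tuple V) : free w ->
  exists2 u : n.-tuple V, orthonormal_frame e u & <<u>>%VS = <<w>>%VS.
Proof.
elim: n w => [|n IH] w; first by exists w; [case | ].
case/tupleP: w => x w; rewrite free_cons => /andP[xw fw].
have [u ou uw] := IH w fw.
pose y := x - lincomb u (\row_j dot x (tnth u j)).
have yu j : dot y (tnth u j) = 0.
  by rewrite /y -scaleN1r dotDl dotZl orthonormal_coord // mxE mulN1r subrr.
have sx : y - x \in <<u>>%VS.
  rewrite /y addrAC subrr add0r rpredN; apply/span_lincomb; by eexists.
have y0 : y != 0.
  apply: contraNneq xw => y0; rewrite -uw -[x]opprK rpredN -[- x]add0r -y0 //.
have n0 : 0 < Num.sqrt (dot y y) by rewrite sqrtr_gt0 dot_gt0.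
pose z := (Num.sqrt (dot y y))^-1 *: y.
have zz : dot z z = 1.
  rewrite /z dotZl dotC dotZl -{3}(sqr_sqrtr (ltW (dot_gt0 y0))).
  by field; rewrite gt_eqF.
have zu j : dot z (tnth u j) = 0 by rewrite /z dotZl yu mulr0.
exists [tuple of z :: u].
  move=> j k; case: (unliftP ord0 j) => [j' ->|->]; case: (unliftP ord0 k) => [k' ->|->];
  rewrite ?tnthS ?tnth0 //; first by rewrite dotC zu.
rewrite !span_cons uw; apply/eqP; rewrite -uw eqEsubv !subv_add !addvSr !andbT.
rewrite -!memvE; apply/andP; split.
  apply: rpredZ; rewrite -[y](subrK x) addrC memv_add ?memv_line //.
have yz : y \in <[z]>%VS.
  apply/vlineP; exists (Num.sqrt (dot y y)).
  by rewrite scalerA mulfV ?scale1r // lt0r_neq0.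
have xu : x - y \in <<u>>%VS by rewrite -opprB rpredN.
by rewrite -[x](subrK y) addrC memv_add.
Qed.

(** The square root of the Gram determinant measures the parallelepiped on [w] without a choice of
    frame in its span. *)
Definition gram n (w : n.-tuple V) : 'M[R]_n := \matrix_(i, j) dot (tnth w i) (tnth w j).

Lemma gram_mul n (w w' : n.-tuple V) (A : 'M[R]_n) :
  (forall i, tnth w' i = lincomb w (row i A)) -> gram w' = A *m gram w *m A^T.
Proof.
move=> wA; apply/matrixP => i j; rewrite !mxE !wA dot_lincombr.
apply: eq_bigr => k _; rewrite dot_lincombl !mxE mulrC; congr (_ * _).
by apply: eq_bigr => l _; rewrite !mxE.
Qed.

Lemma det_gram_mul n (w w' : n.-tuple V) (A : 'M[R]_n) :
  (forall i, tnth w' i = lincomb w (row i A)) ->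
  Num.sqrt (\det (gram w')) = `|\det A| * Num.sqrt (\det (gram w)).
Proof.
move=> wA; rewrite (gram_mul wA) !det_mulmx det_tr mulrAC -expr2.
by rewrite sqrtrM ?sqr_ge0 // sqrtr_sqr.
Qed.

Lemma gram_orthonormal n (u : n.-tuple V) : orthonormal_frame e u -> gram u = 1%:M.
Proof. by move=> ou; apply/matrixP => i j; rewrite !mxE ou. Qed.

Lemma sqrt_det_gram_gt0 n (w : n.-tuple V) : free w -> 0 < Num.sqrt (\det (gram w)).
Proof.
move=> fw; have [u ou uw] := orthonormal_basis fw.
have [A wA] : exists A : 'M[R]_n, forall i, tnth w i = lincomb u (row i A).
  by apply: lincomb_span_matrix => i; rewrite uw; apply/memv_span/mem_tnth.
rewrite (det_gram_mul wA) gram_orthonormal // det1 sqrtr1 mulr1 normr_gt0.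
by rewrite -unitfE -unitmxE (free_unitmx wA).
Qed.

(** Common form of simplices (with [corner_simplex]) and parallelepipeds (with [unit_cube]), so that
    one volume computation serves both. *)
Definition affine_image n (p : V) (w : n.-tuple V) (E : set (n.-tuple R)) : set V :=
  [set x | exists2 t, E t & x = p + lincomb w (rowt t)].

(** Half basis vectors are used because the half-open cube does not contain the basis vectors
    themselves. *)
Lemma direction_affine_image n (p : V) (w : n.-tuple V) E :
  E (trow 0) -> (forall j, E (trow (2^-1 *: delta_mx ord0 j))) ->
  direction (affine_image p w E) = [set` <<w>>%VS].
Proof.
move=> E0 Ej; apply/seteqP; split=> x /=.
  case=> ys Hys; apply: (subvP (_ : (<<ys>> <= <<w>>)%VS)).
  apply/span_subvP => y /Hys[_ [_ [[t _ ->] [t' _ ->] ->]]].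
  rewrite opprD addrACA subrr add0r -lincombB; apply/span_lincomb; by eexists.
move=> xw; exists [seq 2^-1 *: y | y <- w].
  move=> y /mapP[_ /tnthP[j ->] ->].
  exists (p + lincomb w (2^-1 *: delta_mx ord0 j)), p; split.
  - by exists (trow (2^-1 *: delta_mx ord0 j)); rewrite ?trowK.
  - by exists (trow 0); rewrite ?trowK ?lincomb0 ?addr0.
  - by rewrite addrAC subrr add0r lincombZ lincomb_delta.
apply: subvP xw; apply/span_subvP => y yw.
have -> : y = 2 *: (2^-1 *: y) by rewrite scalerA mulfV ?scale1r ?pnatr_eq0.
by apply/rpredZ/memv_span/mapP; exists y.
Qed.

(** Read in an orthonormal frame [u], the set is the preimage of [E] under an affine map with linear
    part [invmx A], where [A] expresses [w] in [u]. Its measure is thus [|\det A| * r], and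
    [|\det A|] is the root of the Gram determinant whatever [u] is. *)
Lemma volume_affine_image n (p : V) (w : n.-tuple V) E r :
  free w -> measurable (E : set (n.-tuple (measurableTypeR R))) ->
  E (trow 0) -> (forall j, E (trow (2^-1 *: delta_mx ord0 j))) ->
  lebesgue_Rn E = r%:E ->
  volume e n (affine_image p w E) = Num.sqrt (\det (gram w)) * r.
Proof.
move=> fw mE E0 Ej Er; have dirE := direction_affine_image p w E0 Ej.
(* [xget] picks an unknown origin and frame, so the value is computed for all of them; the default
   value is excluded by an orthonormal basis of the span of [w]. *)
rewrite /volume; case: xgetP => [v -> {v} [x [u [[t0 Et0 defx] ou]]]|noS]; last first.
  have [u ou uw] := orthonormal_basis fw; case: (noS (fine (lebesgue_Rn
    [set c : n.-tuple R | affine_image p w E (p + \sum_j tnth c j *: tnth u j)]))).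
  exists p, u; split=> //; first by exists (trow 0); rewrite ?trowK ?lincomb0 ?addr0.
  by rewrite dirE uw.
rewrite dirE => /seteqP[wu uw] ->.
have [A wA] : exists A : 'M[R]_n, forall i, tnth w i = lincomb u (row i A).
  apply: lincomb_span_matrix => i; apply: wu; exact/memv_span/mem_tnth.
have uA : A \in unitmx := free_unitmx wA fw.
(* The position of the chosen origin [x] relative to [p], in the frame [u]. *)
pose v := rowt t0 *m A.
pose E' := [set c : n.-tuple (measurableTypeR R) | E (trow (rowt c *m invmx A))].
have mE' : measurable E'.
  have := measurable_preimage_mulmx (invmx A) 0 mE.
  by congr measurable; apply/seteqP; split=> c /=; rewrite addr0.
have -> : [set c : n.-tuple R | affine_image p w E (x + \sum_j tnth c j *: tnth u j)] =
    [set c | E' (trow (rowt c + v))].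
  have sumE (c : n.-tuple R) : \sum_j tnth c j *: tnth u j = lincomb u (rowt c).
    by apply: eq_bigr => j _; rewrite mxE.
  apply/seteqP; split=> c /=; rewrite /affine_image /E' /= sumE trowK.
    move=> [t Et]; rewrite defx -addrA => /addrI.
    rewrite !(lincomb_mul _ wA) -lincombD => /(free_lincomb_inj (orthonormal_free ou)).
    by rewrite addrC => ->; rewrite mulmxK // rowtK.
  move=> Ec; exists (trow ((rowt c + v) *m invmx A)) => //.
  rewrite defx -addrA trowK !(lincomb_mul _ wA) -lincombD mulmxKV //.
  by rewrite [_ *m A + _]addrC.
rewrite lebesgue_Rn_translate // (@unitmx_scales_lebesgue _ _ (invmx A)) ?unitmx_inv //.
rewrite Er -EFinM /= (det_gram_mul wA) gram_orthonormal // det1 sqrtr1 mulr1.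
by rewrite det_inv normrV ?invrK // -unitmxE.
Qed.

End Volume.

(** * Simplices, barycentric coordinates and normalized volume *)

Section Simplices.
Variables (R : realType) (V : vectType R).

(** The base vertex [k] is left free: the upper bounds are taken from the last vertex of a face, the
    lower bounds from the first. *)
Definition edges n (p : n.+1.-tuple V) (k : 'I_n.+1) : n.-tuple V :=
  [tuple tnth p (lift k j) - tnth p k | j < n].

Lemma barycentric_edges n (p : n.+1.-tuple V) k (c : 'I_n.+1 -> R) :
  \sum_j c j *: tnth p j =
    (\sum_j c j) *: tnth p k + lincomb (edges p k) (\row_j c (lift k j)).
Proof.
rewrite (bigD1_ord k) //= (bigD1_ord k (F := c)) //= scalerDl -addrA; congr (_ + _).
rewrite scaler_suml -big_split; apply: eq_bigr => j _.
by rewrite mxE tnth_mktuple scalerBr /= addrC subrK.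
Qed.

Definition edge_barycentric n (k : 'I_n.+1) (t : 'rV[R]_n) (j : 'I_n.+1) : R :=
  if unlift k j is Some j' then t ord0 j' else 1 - \sum_j t ord0 j.

Lemma edge_barycentric_lift n (k : 'I_n.+1) t j :
  edge_barycentric k t (lift k j) = t ord0 j.
Proof. by rewrite /edge_barycentric liftK. Qed.

Lemma edge_barycentric_base n (k : 'I_n.+1) t :
  edge_barycentric k t k = 1 - \sum_j t ord0 j.
Proof. by rewrite /edge_barycentric unlift_none. Qed.

Lemma sum_edge_barycentric n (k : 'I_n.+1) t : \sum_j edge_barycentric k t j = 1.
Proof.
rewrite (bigD1_ord k) //= edge_barycentric_base.
by under eq_bigr do rewrite edge_barycentric_lift; rewrite subrK.
Qed.

Lemma lincomb_edges n (p : n.+1.-tuple V) k t :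
  tnth p k + lincomb (edges p k) t = \sum_j edge_barycentric k t j *: tnth p j.
Proof.
rewrite (barycentric_edges _ k) sum_edge_barycentric scale1r; congr (_ + lincomb _ _).
by apply/rowP => j; rewrite mxE edge_barycentric_lift.
Qed.

Lemma conv_hull_affine_image n (p : n.+1.-tuple V) k :
  conv_hull p = affine_image (tnth p k) (edges p k) (@corner_simplex R n 1).
Proof.
apply/seteqP; split=> x.
  case=> c [c0 c1 ->]; exists (trow (\row_j c (lift k j))).
    split=> [j|]; first by rewrite tnth_mktuple mxE.
    under eq_bigr do rewrite tnth_mktuple mxE.
    by rewrite -c1 (bigD1_ord k) //= lerDr.
  by rewrite trowK (barycentric_edges _ k) c1 scale1r.
case=> t [t0 t1] ->; exists (edge_barycentric k (rowt t)).
have sumE : \sum_j rowt t ord0 j = \sum_j tnth t j by apply: eq_bigr => j _; rewrite mxE.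
split; [|exact: sum_edge_barycentric|exact: lincomb_edges].
move=> j; case: (unliftP k j) => [j' ->|->]; rewrite ?edge_barycentric_lift ?mxE //.
by rewrite edge_barycentric_base sumE subr_ge0.
Qed.

Lemma free_edges n (p : n.+1.-tuple V) k :
  affinely_independent p <-> free (edges p k).
Proof.
split=> [ap|fe].
  apply: lincomb_inj_free => t Ht.
  (* Subtracting the indicator of [k] turns coefficients of sum 1 into an affine dependence. *)
  pose c j := edge_barycentric k t j - (j == k)%:R.
  have c0 : \sum_j c j = 0.
    rewrite sumrB sum_edge_barycentric (bigD1 k) //= eqxx big1 ?addr0 ?subrr // => j.
    by move=> /negPf ->.
  have Hc : \sum_j c j *: tnth p j = 0.
    rewrite (barycentric_edges _ k) c0 scale0r add0r -[RHS]Ht; congr lincomb.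
    apply/rowP => j; rewrite mxE /c edge_barycentric_lift.
    by rewrite (negPf (_ : lift k j != k)) ?subr0 // eq_sym neq_lift.
  apply/rowP => j; have := ap c c0 Hc (lift k j).
  by rewrite /c edge_barycentric_lift (negPf (_ : lift k j != k)) ?subr0 ?mxE // eq_sym neq_lift.
move=> c c0; rewrite (barycentric_edges _ k) c0 scale0r add0r => Hc.
have {Hc} : \row_j c (lift k j) = 0 by apply: (free_lincomb_inj fe); rewrite lincomb0.
move=> /rowP Hc.
have Hl j : c (lift k j) = 0 by have := Hc j; rewrite !mxE.
move=> j; case: (unliftP k j) => [j' ->|->] //; move: c0.
by rewrite (bigD1_ord k) //= big1 ?addr0.
Qed.

Lemma barycentric_inj n (p : n.+1.-tuple V) (c c' : 'I_n.+1 -> R) :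
  affinely_independent p -> \sum_j c j = \sum_j c' j ->
  \sum_j c j *: tnth p j = \sum_j c' j *: tnth p j -> c =1 c'.
Proof.
move=> ap sc sp j; apply/eqP; rewrite -subr_eq0; apply/eqP.
apply: (ap (fun j => c j - c' j)); first by rewrite sumrB sc subrr.
under eq_bigr do rewrite scalerBl.
by rewrite sumrB sp subrr.
Qed.

Lemma corner_simplex_origin n : @corner_simplex R n 1 (trow 0).
Proof.
split=> [j|]; first by rewrite tnth_mktuple mxE.
by rewrite big1 // => j _; rewrite tnth_mktuple mxE.
Qed.

Lemma corner_simplex_half n j :
  @corner_simplex R n 1 (trow (2^-1 *: delta_mx ord0 j)).
Proof.
split=> [k|]; first by rewrite tnth_mktuple !mxE mulr_ge0 ?invr_ge0 ?ler0n.
rewrite (bigD1 j) //= tnth_mktuple !mxE !eqxx mulr1 big1 ?addr0 => [|k /negPf kj].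
  by rewrite invf_le1 ?ler1n ?ltr0n.
by rewrite tnth_mktuple !mxE eqxx kj mulr0.
Qed.

Lemma direction_conv_hull n (p : n.+1.-tuple V) k :
  direction (conv_hull p) = [set` <<edges p k>>%VS].
Proof.
rewrite (conv_hull_affine_image p k); apply: direction_affine_image.
  exact: corner_simplex_origin.
exact: corner_simplex_half.
Qed.

Lemma has_dim_conv_hull n (p : n.+1.-tuple V) :
  affinely_independent p -> has_dim (conv_hull p) n.
Proof.
move=> /(free_edges p ord0) fe.
by exists <<edges p ord0>>%VS; [exact: direction_conv_hull | rewrite (eqP fe) size_tuple].
Qed.

Lemma parallelepiped_affine_image n (b : n.-tuple V) :
  parallelepiped b = affine_image 0 b (@unit_cube R n).
Proof.
apply/seteqP; split=> x.
  case=> t [t01 ->]; exists (trow (\row_j t j)).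
    by move=> j; rewrite tnth_mktuple mxE.
  by rewrite trowK add0r; apply: eq_bigr => j _; rewrite mxE.
case=> t t01 ->; exists (tnth t); split=> //.
by rewrite add0r; apply: eq_bigr => j _; rewrite mxE.
Qed.

Variables (d : nat) (e : d.-tuple V).
Hypothesis he : basis_of {:V} e.

Lemma volume_conv_hull n (p : n.+1.-tuple V) k : affinely_independent p ->
  volume e n (conv_hull p) = Num.sqrt (\det (gram e (edges p k))) / n`!%:R.
Proof.
move=> /(free_edges p k) fe; rewrite (conv_hull_affine_image p k).
apply: (volume_affine_image he) => //.
- exact: measurable_corner_simplex.
- exact: corner_simplex_origin.
- exact: corner_simplex_half.
- by rewrite lebesgue_Rn_simplex // expr1n mul1r.
Qed.

Lemma volume_parallelepiped n (b : n.-tuple V) : free b ->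
  volume e n (parallelepiped b) = Num.sqrt (\det (gram e b)).
Proof.
move=> fb; rewrite parallelepiped_affine_image -[RHS]mulr1.
apply: (volume_affine_image he) => //.
- exact: measurable_unit_cube.
- by move=> j; rewrite tnth_mktuple mxE lexx ltr01.
- move=> j k; rewrite tnth_mktuple !mxE eqxx /=; case: eqP => _.
    by rewrite mulr1 invr_ge0 ler0n invf_lt1 ?ltr0n ?ltr1n.
  by rewrite mulr0 lexx ltr01.
- exact: lebesgue_Rn_cube.
Qed.

(** The Gram determinant of the lattice basis cancels in the quotient, leaving the index of the edge
    lattice divided by [n!]. The basis [b] is existential, being the one selected inside
    [lattice_det]. *)
Lemma normalized_volume_conv_hull (L : set V) n (p : n.+1.-tuple V) k :
  affinely_independent p -> is_lattice (L `&` direction (conv_hull p)) n ->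
  exists b : n.-tuple V, lattice_basis b (L `&` direction (conv_hull p)) /\
    forall A : 'M[R]_n, (forall j, tnth (edges p k) j = lincomb b (row j A)) ->
      normalized_volume e L n (conv_hull p) = `|\det A| / n`!%:R.
Proof.
move=> ap [b0 hb0]; rewrite /normalized_volume (volume_conv_hull k ap) /lattice_det.
case: xgetP => [r -> {r} [b hb ->]|noS]; last first.
  by case: (noS (volume e n (parallelepiped b0))); exists b0.
exists b; split=> // A eA; have [fb _] := hb.
rewrite (det_gram_mul e eA) volume_parallelepiped //.
have s0 := sqrt_det_gram_gt0 he fb.
by rewrite mulrAC mulfK // gt_eqF.
Qed.

End Simplices.

(** * Lattice points of faces *)

Section Lattices.
Variables (R : realType) (V : vectType R).

Lemma lattice_basisE n (b : n.-tuple V) (M : set V) : lattice_basis b M <->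
  free b /\ forall x, M x <-> exists z : 'rV[int]_n, x = lincomb b (map_mx intr z).
Proof.
have sumE (z : 'I_n -> int) : \sum_j tnth b j *~ z j =
    lincomb b (map_mx intr (\row_j z j)).
  by apply: eq_bigr => j _; rewrite !mxE scaler_int.
split=> [[fb ->]|[fb HM]]; split=> //.
  move=> x; split=> [[z ->]|[z ->]]; first by exists (\row_j z j).
  exists (fun j => z ord0 j); rewrite sumE; congr (lincomb _ (map_mx _ _)).
  by apply/rowP => j; rewrite mxE.
apply/seteqP; split=> x /=.
  move=> /HM[z ->]; exists (fun j => z ord0 j); rewrite sumE.
  by congr (lincomb _ (map_mx _ _)); apply/rowP => j; rewrite mxE.
by move=> [z ->]; apply/HM; exists (\row_j z j).
Qed.

Lemma lattice_matrix n m (b : n.-tuple V) M (w : m.-tuple V) : lattice_basis b M ->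
  (forall i, M (tnth w i)) ->
  exists B : 'M[int]_(m, n), forall i, tnth w i = lincomb b (row i (map_mx intr B)).
Proof.
move=> /lattice_basisE[_ HM] Mw.
have /choice[f fP] : forall i, exists z : 'rV[int]_n, tnth w i = lincomb b (map_mx intr z).
  by move=> i; apply/HM.
by exists (\matrix_i f i) => i; rewrite -map_row rowK.
Qed.

Lemma lattice_closed n (b : n.-tuple V) M x y : lattice_basis b M ->
  M x -> M y -> M (x + y).
Proof.
move=> /lattice_basisE[_ HM] /HM[z ->] /HM[z' ->]; apply/HM; exists (z + z').
by rewrite map_mxD lincombD.
Qed.

Lemma lattice_closedN n (b : n.-tuple V) M x : lattice_basis b M -> M x -> M (- x).
Proof.
move=> /lattice_basisE[_ HM] /HM[z ->]; apply/HM; exists (- z).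
by rewrite map_mxN lincombN.
Qed.

Lemma lattice0 n (b : n.-tuple V) M : lattice_basis b M -> M 0.
Proof.
by move=> /lattice_basisE[_ HM]; apply/HM; exists 0; rewrite map_mx0 lincomb0.
Qed.

Lemma lattice_lincomb n m (b : n.-tuple V) M (w : m.-tuple V) (z : 'rV[int]_m) :
  lattice_basis b M -> (forall i, M (tnth w i)) -> M (lincomb w (map_mx intr z)).
Proof.
move=> hb Mw; have [B wB] := lattice_matrix hb Mw.
rewrite (lincomb_mul _ wB) -map_mxM; move/lattice_basisE: hb => [_ HM].
by apply/HM; eexists.
Qed.

Lemma unimodular_lattice_basis n (b b' : n.-tuple V) M (Q : 'M[int]_n) :
  lattice_basis b M -> Q \in unitmx ->
  (forall i, tnth b' i = lincomb b (row i (map_mx intr Q))) -> lattice_basis b' M.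
Proof.
move=> /lattice_basisE[fb HM] uQ eQ; apply/lattice_basisE; split.
  apply: (unitmx_free eQ fb); rewrite unitmxE det_map_mx.
  by apply: rmorph_unit; rewrite -unitmxE.
move=> x; split=> [/HM[z ->]|[z ->]].
  by exists (z *m invmx Q); rewrite (lincomb_mul _ eQ) -map_mxM mulmxKV.
by apply/HM; exists (z *m Q); rewrite (lincomb_mul _ eQ) map_mxM.
Qed.

(** Write the matrix of [w] in the basis [f] in Smith form with right factor [Q]. The rows of [Q]
    give a basis [g] of [L] whose first [i] vectors span the same subspace as [w]; a lattice point
    of this subspace has integer coordinates in [g], supported on these vectors. *)
Lemma lattice_section n i (f : n.-tuple V) (L : set V) (w : i.-tuple V) :
  lattice_basis f L -> free w -> (forall j, L (tnth w j)) ->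
  is_lattice (L `&` [set` <<w>>%VS]) i.
Proof.
move=> hf fw Lw; have [ff _] := hf; have [C wC] := lattice_matrix hf Lw.
have [P uP [Q uQ [s _ defC]]] := int_Smith_normal_form C.
pose g : n.-tuple V := [tuple lincomb f (row j (map_mx intr Q)) | j < n].
have gQ j : tnth g j = lincomb f (row j (map_mx intr Q)) by rewrite tnth_mktuple.
have hg := unimodular_lattice_basis hf uQ gQ; have [fg _] := hg.
have le_in : (i <= n)%N.
  have ww : (<<w>> <= <<f>>)%VS.
    by apply/span_subvP => _ /tnthP[j ->]; rewrite wC; apply/span_lincomb; eexists.
  by have := dimvS ww; rewrite (eqP fw) (eqP ff) !size_tuple.
pose b : i.-tuple V := [tuple tnth g (widen_ord le_in j) | j < i].
pose S : 'M[R]_(i, n) := \matrix_(j, k) (k == widen_ord le_in j)%:R.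
have bS j : tnth b j = lincomb g (row j S).
  rewrite tnth_mktuple -lincomb_delta; congr lincomb.
  by apply/rowP => k; rewrite !mxE.
have tS (t : 'rV[R]_i) j : (t *m S) ord0 (widen_ord le_in j) = t ord0 j.
  rewrite mxE (bigD1 j) //= mxE eqxx mulr1 big1 ?addr0 // => k kj.
  by rewrite mxE (_ : _ == _ = false) ?mulr0 // -val_eqE /= eq_sym; apply/negbTE.
have fb : free b.
  apply: lincomb_inj_free => t; rewrite (lincomb_mul _ bS) -(lincomb0 g).
  by move=> /(free_lincomb_inj fg) H; apply/rowP => j; rewrite -tS H !mxE.
(* The square part of the Smith form, invertible over the reals since [w] is free; hence [b] and [w]
   have the same span. *)
pose A := map_mx intr (P *m diag_mx (\row_(j < i) s`_j)) : 'M[R]_i.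
have wA j : tnth w j = lincomb b (row j A).
  rewrite wC (lincomb_mul _ bS) defC map_mxM row_mul -(lincomb_mul _ gQ).
  congr lincomb; rewrite -row_mul; congr row; rewrite /A !map_mxM -mulmxA; congr (_ *m _).
  apply/matrixP => k l; rewrite map_diag_mx mul_diag_mx !mxE -val_eqE /= eq_sym.
  by case: eqP => _; rewrite ?mulr1 ?mulr0.
have uA := free_unitmx wA fw.
have bw j : tnth b j = lincomb w (row j (invmx A)).
  by rewrite (lincomb_mul _ wA) -row_mul mulVmx // row1 lincomb_delta.
exists b; apply/lattice_basisE; split=> // x; split=> [[Lx xw]|[z ->]].
  have [t xt] : exists t, x = lincomb b t.
    move/span_lincomb: xw => [t ->]; exists (t *m A); exact: lincomb_mul.
  have [_ Hg] := (lattice_basisE _ _).1 hg; have [z xz] := (Hg x).1 Lx.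
  exists (\row_j z ord0 (widen_ord le_in j)).
  rewrite xt; congr lincomb; apply/rowP => j; rewrite -tS.
  have : t *m S = map_mx intr z.
    by apply: (free_lincomb_inj fg); rewrite -(lincomb_mul _ bS) -xt.
  by move=> ->; rewrite !mxE.
split.
  apply: (lattice_lincomb _ hg) => j; rewrite tnth_mktuple.
  have [_ Hg] := (lattice_basisE _ _).1 hg; apply/Hg.
  by exists (delta_mx ord0 (widen_ord le_in j)); rewrite map_delta_mx lincomb_delta.
by apply/span_lincomb; exists (map_mx intr z *m invmx A); rewrite -(lincomb_mul _ bw).
Qed.

End Lattices.

(** * Faces spanned by vertices, and the number of their lattice points *)

Section FacesAndPoints.
Variables (R : realType) (V : vectType R).

Lemma sum_codom (W : nmodType) n m (s : 'I_m -> 'I_n) (F : 'I_n -> W) :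
  injective s -> (forall k, k \notin codom s -> F k = 0) ->
  \sum_k F k = \sum_j F (s j).
Proof.
move=> si F0; rewrite (bigID [in codom s]) /= [X in _ + X]big1 // addr0.
rewrite -big_uniq /=; last by rewrite map_inj_uniq ?enum_uniq.
by rewrite big_image.
Qed.

(** Summing over the fibres of [s] makes total mass and linear combinations transfer without
    injectivity of [s]. *)
Definition extend0 n m (s : 'I_m -> 'I_n) (c : 'I_m -> R) (k : 'I_n) : R :=
  \sum_(j | s j == k) c j.

Lemma extend0E n m (s : 'I_m -> 'I_n) c j : injective s -> extend0 s c (s j) = c j.
Proof. by move=> si; rewrite /extend0 (big_pred1 j) // => k; rewrite /= (inj_eq si). Qed.

Lemma extend0_notin n m (s : 'I_m -> 'I_n) c k : k \notin codom s -> extend0 s c k = 0.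
Proof.
move=> ks; rewrite /extend0 big_pred0 // => j.
by apply: contraNF ks => /eqP <-; exact: codom_f.
Qed.

Lemma sum_extend0 n m (s : 'I_m -> 'I_n) c : \sum_k extend0 s c k = \sum_j c j.
Proof. by rewrite [RHS](partition_big s xpredT). Qed.

Lemma comb_extend0 n m (s : 'I_m -> 'I_n) (v : n.-tuple V) c :
  \sum_k extend0 s c k *: tnth v k = \sum_j c j *: tnth v (s j).
Proof.
rewrite [RHS](partition_big s xpredT) //=; apply: eq_bigr => k _.
by rewrite scaler_suml; apply: eq_bigr => j /eqP ->.
Qed.

Definition subtuple n m (s : 'I_m -> 'I_n) (v : n.-tuple V) : m.-tuple V :=
  [tuple tnth v (s j) | j < m].

Lemma affinely_independent_subtuple n m (s : 'I_m -> 'I_n) (v : n.-tuple V) :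
  injective s -> affinely_independent v -> affinely_independent (subtuple s v).
Proof.
move=> si av c c0 cv j; rewrite -(extend0E c j si); apply: av.
  by rewrite sum_extend0.
by rewrite comb_extend0 -[RHS]cv; apply: eq_bigr => k _; rewrite tnth_mktuple.
Qed.

Lemma conv_hull_subtuple n m (s : 'I_m -> 'I_n) (v : n.-tuple V) :
  conv_hull (subtuple s v) `<=` conv_hull v.
Proof.
move=> x [c [c0 c1 ->]]; exists (extend0 s c); split.
- by move=> k; apply: sumr_ge0.
- by rewrite sum_extend0.
- by rewrite comb_extend0; apply: eq_bigr => j _; rewrite tnth_mktuple.
Qed.

(** Coordinates along the edges from the first vertex prescribe the differences of the values; the
    constant [h] absorbs the value at that vertex. *)
Lemma affine_functional n (p : n.+1.-tuple V) (g : 'I_n.+1 -> R) :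
  affinely_independent p -> exists (f : {linear V -> R^o}) (h : R),
    forall j, f (tnth p j) = h + g j.
Proof.
move=> /(free_edges p ord0) fe.
pose F : 'Hom(V, R^o) := \sum_(j < n) (g (lift ord0 j) - g ord0) *: linfun (coord (edges p ord0) j).
have FE t : F (lincomb (edges p ord0) t) = \sum_j t ord0 j * (g (lift ord0 j) - g ord0).
  rewrite sum_lfunE; apply: eq_bigr => j _; rewrite scale_lfunE lfunE /= mulrC.
  congr (_ * _); rewrite /lincomb; under eq_bigr do rewrite (tnth_nth 0).
  by rewrite coord_sum_free.
exists F, (F (tnth p ord0) - g ord0) => j.
case: (unliftP ord0 j) => [j' ->|->]; last by rewrite subrK.
rewrite -[tnth p (lift ord0 j')](subrK (tnth p ord0)) linearD /=.
have -> : tnth p (lift ord0 j') - tnth p ord0 =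
    lincomb (edges p ord0) (delta_mx ord0 j') by rewrite lincomb_delta tnth_mktuple.
rewrite FE (bigD1 j') //= mxE !eqxx mul1r big1 ?addr0 => [|k /negPf kj].
  by rewrite addrC addrAC addrA.
by rewrite mxE eqxx kj mul0r.
Qed.

Lemma affine_functionalE n (p : n.-tuple V) (f : {linear V -> R^o}) (h : R) (g c : 'I_n -> R) :
  (forall j, f (tnth p j) = h + g j) -> \sum_j c j = 1 ->
  f (\sum_j c j *: tnth p j) = h + \sum_j c j * g j.
Proof.
move=> fg c1; rewrite linear_sum /= -[h]mul1r -c1 mulr_suml -big_split /=.
by apply: eq_bigr => j _; rewrite linearZ /= fg; exact: mulrDr.
Qed.

(** The face is exposed by a functional equal to [h] on the selected vertices and to [h - 1] on the
    others. *)
Lemma is_face_subtuple n m (s : 'I_m -> 'I_n.+1) (v : n.+1.-tuple V) :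
  injective s -> affinely_independent v ->
  is_face (conv_hull v) (conv_hull (subtuple s v)).
Proof.
move=> si av; pose g (k : 'I_n.+1) : R := - (k \notin codom s)%:R.
have [f [h fg]] := affine_functional g av.
have g0 c k : 0 <= c k -> c k * g k <= 0.
  by move=> ck; rewrite /g mulrN oppr_le0 mulr_ge0.
exists f, h; split.
  move=> x [c [c0 c1 ->]]; rewrite (affine_functionalE fg c1) gerDl.
  by apply: sumr_le0 => k _; exact: g0.
apply/seteqP; split=> x.
  move=> xs; split; first exact: conv_hull_subtuple xs.
  case: xs => c [c0 c1 ->] /=.
  have -> : \sum_j c j *: tnth (subtuple s v) j = \sum_k extend0 s c k *: tnth v k.
    by rewrite comb_extend0; apply: eq_bigr => j _; rewrite tnth_mktuple.
  rewrite (affine_functionalE fg) ?sum_extend0 // big1 ?addr0 // => k _.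
  rewrite /g; case: (boolP (k \in codom s)) => ks; first by rewrite oppr0 mulr0.
  by rewrite extend0_notin // mul0r.
case=> -[c [c0 c1 ->]] /=; rewrite (affine_functionalE fg c1) => /eqP.
rewrite addrC -subr_eq0 addrK => /eqP sum0.
have ck k : k \notin codom s -> c k = 0.
  move=> ks; have : c k * g k = 0.
    apply/eqP; rewrite -oppr_eq0; apply/eqP.
    have : \sum_k - (c k * g k) = 0 by rewrite sumrN sum0 oppr0.
    by move/psumr_eq0P => -> // j _; rewrite oppr_ge0 g0.
  by rewrite /g ks mulrN mulr1 => /eqP; rewrite oppr_eq0 => /eqP.
exists (c \o s); split=> [j||] /=; first exact: c0.
  by rewrite -c1 (sum_codom si).
rewrite (sum_codom si) => [|k /ck ->]; last by rewrite scale0r.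
by apply: eq_bigr => j _; rewrite tnth_mktuple.
Qed.

Lemma injective_card (S : set V) (I : finType) (g : V -> I) :
  {in S &, injective g} -> exists2 m, (S #= `I_m)%card & (m <= #|I|)%N.
Proof.
move=> gi; pose h x := nat_of_ord (enum_rank (g x)).
have hi : {in S &, injective h}.
  by move=> x y Sx Sy /val_inj/enum_rank_inj; exact: gi.
have le : (S #<= `I_#|I|)%card.
  rewrite -(card_le_eql (inj_card_eq hi)); apply: subset_card_le => _ [x _ <-].
  exact: ltn_ord.
have /finite_setP[m Sm] : finite_set S by apply/finite_set_leP; eexists; exact: le.
by exists m => //; rewrite -card_le_II -(card_le_eql Sm).
Qed.

(** The [n] vertices other than the base vertex get labels of their own; every other lattice point
    [y] is labelled by the class of [y - p_k] modulo the edges. Points of one class differ by an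
    integer combination of edges, and a nonzero coefficient pushes a barycentric coordinate of one
    of them up to 1, making it a vertex already labelled. *)
Lemma count_conv_hull n N (p : n.+1.-tuple V) k (f : N.-tuple V) (L : set V)
    (b : n.-tuple V) (B : 'M[int]_n) :
  affinely_independent p -> lattice_basis f L -> (forall j, L (tnth p j)) ->
  lattice_basis b (L `&` [set` <<edges p k>>%VS]) ->
  (forall j, tnth (edges p k) j = lincomb b (row j (map_mx intr B))) ->
  exists2 m, (conv_hull p `&` L #= `I_m)%card & (m <= n + absz (\det B))%N.
Proof.
move=> ap hf Lp hb eB; have fe := (free_edges p k).1 ap.
have nzB : \det B != 0.
  have := free_unitmx eB fe.
  by rewrite unitmxE det_map_mx unitfE intr_eq0.
have [I [phi [cardI phiP]]] := residue_class nzB.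
have [_ Hb] := (lattice_basisE _ _).1 hb.
pose S := conv_hull p `&` L.
have /choice[z zP] : forall y, exists z : 'rV[int]_n,
    S y -> y - tnth p k = lincomb b (map_mx intr z).
  move=> y; have [[Cy Ly]|nS] := pselect (S y); last by exists 0.
  have /Hb[z ->] : (L `&` [set` <<edges p k>>%VS]) (y - tnth p k); last by exists z.
  split; first by apply: (lattice_closed hf Ly); exact: (lattice_closedN hf).
  move: Cy; rewrite (conv_hull_affine_image p k) => -[t _ ->]; rewrite mksetE.
  by rewrite addrAC subrr add0r; apply/span_lincomb; eexists.
pose g y : 'I_n + I :=
  if [pick j | y == tnth p (lift k j)] is Some j then inl j else inr (phi (z y)).
suff gi : {in S &, injective g}.
  have [m Sm lem] := injective_card gi; exists m => //.
  by move: lem; rewrite card_sum card_ord cardI.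
move=> y y'; rewrite !inE => Sy Sy'; rewrite /g.
case: pickP => [j /eqP ->|nv]; case: pickP => [j' /eqP ->|nv'] //; first by move=> [->].
move=> [/phiP[t zt]].
have yy : y - y' = lincomb (edges p k) (map_mx intr t).
  rewrite (lincomb_mul _ eB) -map_mxM -zt map_mxB lincombB -!zP //.
  by rewrite opprB addrA subrK.
have vertex c j : (forall i, 0 <= c i) -> \sum_i c i = 1 -> 1 <= c (lift k j) ->
    \sum_i c i *: tnth p i = tnth p (lift k j).
  move=> c0; rewrite (bigD1 (lift k j)) //= => c1 cj.
  have s0 : \sum_(i | i != lift k j) c i = 0.
    by apply/eqP; rewrite eq_le sumr_ge0 // andbT -(lerD2l (c (lift k j))) c1 addr0.
  have ci i : i != lift k j -> c i = 0 by move: i; apply/psumr_eq0P.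
  rewrite (bigD1 (lift k j)) //= big1 => [|i /ci ->]; last by rewrite scale0r.
  by move: c1; rewrite s0 !addr0 => ->; rewrite scale1r.
move: (Sy) (Sy') => [[c [c0 c1 yc]] _] [[c' [c0' c1' yc']] _].
have ct j : c (lift k j) - c' (lift k j) = (t ord0 j)%:~R.
  have : lincomb (edges p k) (\row_j (c (lift k j) - c' (lift k j))) =
      lincomb (edges p k) (map_mx intr t).
    rewrite -yy yc yc' !(barycentric_edges _ k) c1 c1' !scale1r.
    rewrite opprD addrACA subrr add0r -lincombB; congr lincomb.
    by apply/rowP => i; rewrite !mxE.
  by move/(free_lincomb_inj fe)/rowP/(_ j); rewrite !mxE.
(* A positive entry would make [y] a vertex other than [p_k], a negative one would do so for
   [y']. *)
have t0 : t = 0.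
  apply/rowP => j; rewrite mxE; apply/eqP; rewrite eq_le; apply/andP; split.
    rewrite leNgt; apply/negP => tj; have := nv j.
    rewrite yc (vertex c j) ?eqxx // -[leRHS](subrK (c' (lift k j))) ct.
    by rewrite (le_trans (_ : 1 <= (t ord0 j)%:~R)) ?lerDl // ler1z.
  rewrite leNgt; apply/negP => tj; have := nv' j.
  rewrite yc' (vertex c' j) ?eqxx // -[leRHS](subrK (c (lift k j))) -opprB ct.
  rewrite (le_trans (_ : 1 <= - (t ord0 j)%:~R)) ?lerDl // -rmorphN ler1z.
  by rewrite -oppr_gt0 in tj; exact: tj.
by apply/eqP; rewrite -subr_eq0 yy t0 map_mx0 lincomb0.
Qed.

End FacesAndPoints.

(** * Interior points have positive barycentric coordinates *)

Section Interior.
Variables (R : realType) (V : vectType R) (d : nat) (e : d.-tuple V).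
Hypothesis he : basis_of {:V} e.

Lemma lincomb_coords x : lincomb e (coords e x) = x.
Proof.
have xe : x \in <<e>>%VS by rewrite (span_basis he) memvf.
by rewrite [RHS](coord_span xe); apply: eq_bigr => j _; rewrite mxE (tnth_nth 0).
Qed.

Lemma coords_lincomb t : coords e (lincomb e t) = t.
Proof. by apply: (free_lincomb_inj (basis_free he)); rewrite lincomb_coords. Qed.

Lemma cvg_sum_entries n (a : 'I_n -> R) (y0 : 'rV[R]_n) :
  (\sum_j y ord0 j * a j) @[y --> y0] --> \sum_j y0 ord0 j * a j.
Proof.
elim: (index_enum 'I_n) => [|j r IH].
  by rewrite big_nil; under eq_fun do rewrite big_nil; exact: cvg_cst.
rewrite big_cons; under eq_fun do rewrite big_cons.
by apply: cvgD => //; apply: cvgMr_tmp; exact: coord_continuous.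
Qed.

Lemma affine_hull_full (v : d.+1.-tuple V) y : affinely_independent v ->
  exists c, \sum_k c k = 1 /\ y = \sum_k c k *: tnth v k.
Proof.
move=> av; have fe := (free_edges v ord0).1 av.
have : y - tnth v ord0 \in <<edges v ord0>>%VS.
  have -> : <<edges v ord0>>%VS = fullv; last exact: memvf.
  apply/eqP; rewrite eqEdim subvf /= (eqP fe) size_tuple.
  by rewrite -(span_basis he) (eqP (basis_free he)) size_tuple.
move/span_lincomb => [t yt]; exists (edge_barycentric ord0 t).
by rewrite sum_edge_barycentric -lincomb_edges -yt addrC subrK.
Qed.

(** Each barycentric coordinate is an affine function [f k - h k]. Finitely many strict inequalities
    between continuous functions persist near [x]; conversely, at a point with a zero coordinate a
    small move away from the opposite vertex leaves the simplex. *)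
Lemma interior_conv_hull (v : d.+1.-tuple V) (c : 'I_d.+1 -> R) :
  affinely_independent v -> \sum_k c k = 1 ->
  interior_in_coords e (conv_hull v) (\sum_k c k *: tnth v k) <-> forall k, 0 < c k.
Proof.
move=> av c1; set x := \sum_k _.
have /choice[f /choice[h fh]] : forall k : 'I_d.+1, exists (f : {linear V -> R^o}) (h : R),
    forall j, f (tnth v j) = h + (k == j)%:R.
  by move=> k; exact: affine_functional.
have fE k c' : \sum_j c' j = 1 -> f k (\sum_j c' j *: tnth v j) = h k + c' k.
  move=> c1'; rewrite (affine_functionalE (fh k) c1'); congr (_ + _).
  rewrite (bigD1 k) //= eqxx mulr1 big1 ?addr0 // => j /negPf.
  by rewrite eq_sym => ->; rewrite mulr0.
have TE y : conv_hull v y -> forall k, h k <= f k y.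
  by move=> [c' [c0' c1' ->]] k; rewrite fE // lerDl.
have ET y : (forall k, h k < f k y) -> conv_hull v y.
  move=> Hy; have [c' [c1' yc]] := affine_hull_full y av.
  by exists c'; split=> // k; have := Hy k; rewrite yc fE // ltrDl => /ltW.
split=> [|cp].
  rewrite /interior_in_coords /interior /= => -[P nP sP] k.
  have xT : conv_hull v x.
    have [y Ty] : (coords e @` conv_hull v) (coords e x).
      by apply: sP => i j; apply: nbhs_singleton; exact: nP.
    by move/(congr1 (lincomb e)); rewrite !lincomb_coords => <-.
  have ck : 0 <= c k by have := TE x xT k; rewrite fE // lerDl.
  rewrite lt_neqAle ck andbT; apply/eqP => /esym ck0.
  pose u := x - tnth v k.
  (* A neighbourhood of a row vector contains a product of neighbourhoods [P] of its entries, so the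
     segment is followed entry by entry. *)
  have : \forall s \near (0 : R), forall j, P ord0 j (coords e x ord0 j + s * coords e u ord0 j).
    have F0 : Filter (nbhs (0 : R)) by exact: nbhs_filter.
    refine (@filter_forall R 'I_d
      (fun (j : 'I_d) => [set s : R | P ord0 j (coords e x ord0 j + s * coords e u ord0 j)])
      (nbhs (0 : R)) F0 _) => j.
    have : (coords e x ord0 j + s * coords e u ord0 j) @[s --> (0 : R)] -->
        coords e x ord0 j + 0 * coords e u ord0 j.
      by apply: cvgD; [exact: cvg_cst | apply: cvgMr_tmp; exact: cvg_id].
    by rewrite mul0r addr0; apply; exact: nP.
  move=> /nbhs_ballP[r /= r0 rP].
  have : (coords e @` conv_hull v) (coords e (x + (r / 2) *: u)).
    apply: sP => i j; rewrite (ord1 i) !mxE linearD linearZ /=.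
    have := rP (r / 2); rewrite /ball /= sub0r normrN gtr0_norm ?divr_gt0 //.
    by move=> /(_ _ j); rewrite !mxE; apply; lra.
  (* The coordinate on [v_k] of the moved point is [- (r / 2)]. *)
  case=> y Ty /(congr1 (lincomb e)); rewrite !lincomb_coords => yE.
  have := TE _ Ty k; rewrite yE linearD linearZ linearB /= fE // fh eqxx ck0 addr0.
  rewrite opprD addrA subrr sub0r.
  have -> : (r / 2) *: (- (1%:R) : R^o) = - (r / 2) by exact: mulrN1.
  rewrite lerDl oppr_ge0; apply/negP; by rewrite -ltNge divr_gt0.
rewrite /interior_in_coords /interior /=.
pose phi k (y : 'rV[R]_d) := \sum_j y ord0 j * f k (tnth e j).
have phiE k y : phi k y = f k (lincomb e y).
  by rewrite linear_sum; apply: eq_bigr => j _; rewrite linearZ.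
have near_phi : \forall y \near coords e x, forall k, h k < phi k y.
  have Fx : Filter (nbhs (coords e x)) by exact: nbhs_filter.
  apply: (@filter_forall _ _ (fun (k : 'I_d.+1) => [set y | h k < phi k y]) (nbhs (coords e x)) Fx) => k.
  have : phi k y @[y --> coords e x] --> phi k (coords e x) by exact: cvg_sum_entries.
  move/cvgr_gt; apply.
  by rewrite phiE lincomb_coords fE // ltrDl.
apply: filterS near_phi => y Hy; exists (lincomb e y); last exact: coords_lincomb.
by apply: ET => k; rewrite -phiE.
Qed.

End Interior.

(** * Barycentric coordinates of a unique interior lattice point *)

Section UniqueInteriorPoint.
Variables (R : realType) (V : vectType R) (d : nat) (f : d.-tuple V) (L : set V).
Hypothesis hf : lattice_basis f L.
Variable v : d.+1.-tuple V.
Hypotheses (av : affinely_independent v) (Lv : forall j, L (tnth v j)).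
Variable beta : 'I_d.+1 -> R.
Hypotheses (beta_gt0 : forall k, 0 < beta k) (sum_beta : \sum_k beta k = 1).
Hypothesis Lx : L (\sum_k beta k *: tnth v k).
Hypothesis beta_unique : forall g, (forall k, 0 < g k) -> \sum_k g k = 1 ->
  L (\sum_k g k *: tnth v k) -> g =1 beta.

(** Otherwise [beta + g] would be the coordinates of a second interior lattice point. *)
Lemma no_small_lattice_vector (g : 'I_d.+1 -> R) : \sum_k g k = 0 ->
  L (\sum_k g k *: tnth v k) -> (forall k, - beta k < g k) -> forall k, g k = 0.
Proof.
move=> g0 Lg gb k.
have : beta k + g k = beta k.
  apply: (beta_unique (g := fun k => beta k + g k)).
  - by move=> j; have := gb j; lra.
  - by rewrite big_split /= sum_beta g0 addr0.
  - under eq_bigr do rewrite scalerDl; rewrite big_split /=.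
    exact: (lattice_closed hf).
by move/eqP; rewrite addrC -subr_eq0 addrK => /eqP.
Qed.

(** Cramer's rule: in the basis [f] the edges have an integer matrix [B], and the lattice point has
    integer coordinates relative to the first vertex, so [\det B] is a common denominator. *)
Lemma barycentric_rational : exists (q : int) (a : 'I_d.+1 -> int),
  0 < q /\ forall k, q%:~R * beta k = (a k)%:~R.
Proof.
pose w := edges v ord0; have fw : free w := (free_edges v ord0).1 av.
have Lw j : L (tnth w j).
  by rewrite tnth_mktuple; apply: (lattice_closed hf) => //; exact: (lattice_closedN hf).
have [B wB] := lattice_matrix hf Lw.
have nzB : \det B != 0.
  by have := free_unitmx wB fw; rewrite unitmxE det_map_mx unitfE intr_eq0.
pose t := \row_j beta (lift ord0 j).
have [ff HL] := (lattice_basisE _ _).1 hf.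
have [z zE] : exists z : 'rV[int]_d, lincomb w t = lincomb f (map_mx intr z).
  apply/HL; have := lattice_closed hf Lx (lattice_closedN hf (Lv ord0)).
  by rewrite (barycentric_edges _ ord0) sum_beta scale1r addrAC subrr add0r.
have tB : t *m map_mx intr B = map_mx intr z.
  by apply: (free_lincomb_inj ff); rewrite -(lincomb_mul _ wB).
pose a := z *m \adj B.
have aE j : (\det B)%:~R * t ord0 j = (a ord0 j)%:~R.
  have := congr1 (mulmx^~ (map_mx intr (\adj B))) tB.
  rewrite -mulmxA -!map_mxM mul_mx_adj map_scalar_mx mul_mx_scalar.
  by move/rowP/(_ j); rewrite !mxE.
(* Squaring makes the denominator positive. *)
pose q := \det B * \det B.
have aL j : q%:~R * beta (lift ord0 j) = (\det B * a ord0 j)%:~R.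
  by have := aE j; rewrite mxE /q !intrM -mulrA => ->.
exists q, (fun k => if unlift ord0 k is Some j then \det B * a ord0 j
  else q - \sum_j \det B * a ord0 j); split.
  by rewrite /q -expr2 lt_neqAle sqr_ge0 eq_sym sqrf_eq0 nzB.
move=> k; case: unliftP => [j ->|->] //.
rewrite rmorphB rmorph_sum /=; under eq_bigr do rewrite -aL.
rewrite -mulr_sumr -[X in _ = X - _]mulr1 -mulrBr; congr (_ * _).
by rewrite -sum_beta (bigD1_ord ord0) //= addrK.
Qed.

(** If the inequality failed, [\det C] would be smaller than the product of the radii
    [q * beta (s j)], and Minkowski's theorem would give a forbidden lattice vector. The vertex [k0]
    outside the family makes [\det C] positive and shows that the vector found is nonzero. *)
Lemma barycentric_product_sum m (s : 'I_m -> 'I_d.+1) k0 :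
  injective s -> k0 \notin codom s ->
  \prod_j beta (s j) <= 1 - \sum_j beta (s j).
Proof.
move=> si k0s; rewrite leNgt; apply/negP => lt_prod.
have [q [a [q0 qa]]] := barycentric_rational.
have q0R : 0 < q%:~R :> R by rewrite ltr0z.
pose u : 'cV[int]_m := const_mx 1; pose av' : 'rV[int]_m := \row_j a (s j).
(* Up to the factor [q], row [z *m C] lists the negated components of
   [\sum_j z_j (x - v_(s j))] on the vertices [v_(s j)]. *)
pose C : 'M[int]_m := q%:M - u *m av'.
pose b' : 'rV[R]_m := \row_j beta (s j).
have CE : map_mx intr C = q%:~R *: (1%:M - const_mx 1 *m b') :> 'M[R]_m.
  rewrite /C map_mxB map_mxM map_scalar_mx scalerBr scalemx1; congr (_ - _).
  rewrite scalemxAr; congr (_ *m _).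
    by apply/matrixP => i j; rewrite !mxE.
  by apply/rowP => j; rewrite !mxE qa.
have sumlt : 0 < 1 - \sum_j beta (s j).
  rewrite -sum_beta (bigID [in codom s]) /=.
  have -> : \sum_(k in codom s) beta k = \sum_j beta (s j).
    by rewrite -big_uniq ?big_image //= map_inj_uniq ?enum_uniq.
  rewrite addrAC subrr add0r (bigD1 k0) //= ltr_wpDr //.
  by apply: sumr_ge0 => k _; exact: ltW.
have detC : (\det C)%:~R = q%:~R ^+ m * (1 - \sum_j beta (s j)) :> R.
  rewrite -det_map_mx CE detZ det_1_sub_rank1; congr (_ * (1 - _)).
  by rewrite mxE; apply: eq_bigr => j _; rewrite !mxE mulr1.
have detC0 : 0 < (\det C)%:~R :> R by rewrite detC mulr_gt0 ?exprn_gt0.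
have [||| z z0 zP] := @minkowski_linear_forms R m C (fun j => q%:~R * beta (s j)).
- by rewrite -(intr_eq0 R) gt_eqF.
- by move=> j; rewrite mulr_gt0.
- rewrite big_split /= prodr_const card_ord intr_norm gtr0_norm // detC.
  by rewrite ltr_pM2l // exprn_gt0.
pose zR : 'rV[R]_m := map_mx intr z.
have {zP} bound (z' : 'rV[int]_m) : (z' = z \/ z' = - z) ->
    forall j, `|(\sum_i z' ord0 i)%:~R * beta (s j) - (z' ord0 j)%:~R| < beta (s j).
  move=> z'E j.
  have zC : `|(z' *m C) ord0 j|%:~R < q%:~R * beta (s j) :> R.
    case: z'E => ->; first exact: zP.
    have -> : (- z *m C) ord0 j = - (z *m C) ord0 j by rewrite mulNmx [LHS]mxE.
    by rewrite normrN; exact: zP.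
  have CjE : (z' *m C) ord0 j = q * z' ord0 j - (\sum_i z' ord0 i) * a (s j).
    rewrite /C mulmxBr mul_mx_scalar mulmxA !mxE; congr (_ - _).
    rewrite big_ord1 !mxE; congr (_ * _).
    by apply: eq_bigr => i _; rewrite mxE mulr1.
  rewrite -(ltr_pM2l q0R) -{1}(gtr0_norm q0R) -normrM mulrBr mulrCA qa.
  by move: zC; rewrite CjE intr_norm distrC rmorphB !rmorphM /= qa.
(* The sign is chosen so that the components off the family, which are multiples [M * beta k], are
   nonnegative. *)
have [z' z'E m0] : exists2 z', (z' = z \/ z' = - z) & 0 <= \sum_i z' ord0 i.
  case: (leP 0 (\sum_i z ord0 i)) => sz; first by exists z; [left|].
  exists (- z); first by right.
  under eq_bigr do rewrite mxE; by rewrite sumrN oppr_ge0 ltW.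
pose M := \sum_i z' ord0 i.
pose g k := M%:~R * beta k - extend0 s (fun j => (z' ord0 j)%:~R) k.
have g0 : forall k, g k = 0.
  apply: no_small_lattice_vector.
  - by rewrite sumrB -mulr_sumr sum_beta mulr1 sum_extend0 /M rmorph_sum subrr.
  - rewrite /g; under eq_bigr do rewrite scalerBl -scalerA.
    rewrite sumrB -scaler_sumr comb_extend0; apply: (lattice_closed hf).
      have -> : M%:~R *: \sum_k beta k *: tnth v k =
        lincomb [tuple \sum_k beta k *: tnth v k] (map_mx intr (const_mx M : 'rV[int]_1)).
        by rewrite /lincomb big_ord1 !mxE (tnth_nth 0).
      by apply: (lattice_lincomb _ hf) => i; rewrite (ord1 i).
    apply: (lattice_closedN hf).
    have -> : \sum_j (z' ord0 j)%:~R *: tnth v (s j) =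
        lincomb (subtuple s v) (map_mx intr z').
      by apply: eq_bigr => j _; rewrite mxE tnth_mktuple.
    by apply: (lattice_lincomb _ hf) => i; rewrite tnth_mktuple.
  - move=> k; rewrite /g; have Mb : 0 <= M%:~R * beta k.
      by apply: mulr_ge0; [rewrite ler0z | exact: ltW].
    case: (boolP (k \in codom s)) => [/codomP[j ->]|ks].
      by rewrite extend0E //; have := bound _ z'E j; rewrite ltr_norml => /andP[].
    by rewrite extend0_notin // subr0 (lt_le_trans _ Mb) // oppr_lt0.
(* At [k0] only [M * beta k0] is left; [M = 0] then forces [z' = 0], against [z != 0]. *)
have M0 : M%:~R = 0 :> R.
  have := g0 k0; rewrite /g extend0_notin // subr0 => /eqP.
  by rewrite mulf_eq0 (gt_eqF (beta_gt0 k0)) orbF => /eqP.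
have z'0 : z' = 0.
  apply/rowP => j; rewrite mxE; have := g0 (s j).
  by rewrite /g extend0E // M0 mul0r sub0r => /eqP; rewrite oppr_eq0 intr_eq0 => /eqP.
case: z'E z0 => zz; first by rewrite -zz z'0 eqxx.
by rewrite -[z]opprK -zz z'0 oppr0 eqxx.
Qed.

(* A lattice vector with coordinates [z] in the basis [b] has coordinates
   [z *m \adj B / \det B] along the edges; the component on the base vertex [k] is
   only made nonnegative, by the choice of a sign. *)
Lemma face_index_bound i (s : 'I_i.+1 -> 'I_d.+1) k (b : i.-tuple V) (B : 'M[int]_i) :
  injective s -> lattice_basis b (L `&` [set` <<edges (subtuple s v) k>>%VS]) ->
  (forall j, tnth (edges (subtuple s v) k) j = lincomb b (row j (map_mx intr B))) ->
  `|\det B|%:~R * \prod_j beta (s (lift k j)) <= 1.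
Proof.
move=> si hb eB; rewrite leNgt; apply/negP => lt1.
have ap := affinely_independent_subtuple si av.
have fe := (free_edges (subtuple s v) k).1 ap.
have nzB : \det B != 0.
  by have := free_unitmx eB fe; rewrite unitmxE det_map_mx unitfE intr_eq0.
have D0 : 0 < `|\det B|%:~R :> R by rewrite ltr0z normr_gt0.
(* Multiplied by [|\det B|], the hypothesis of Minkowski's theorem for [\adj B] becomes the negated
   conclusion; this also avoids the exponent [i - 1]. *)
have detadj : \det B * \det (\adj B) = \det B ^+ i.
  by rewrite -det_mulmx mul_mx_adj det_scalar.
have nzadj : \det (\adj B) != 0.
  apply: contraTneq (expf_neq0 i nzB) => adj0.
  by rewrite -detadj adj0 mulr0 eqxx.
have [||| z z0 zP] := @minkowski_linear_forms R i (\adj B)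
    (fun j => `|\det B|%:~R * beta (s (lift k j))).
- by [].
- by move=> j; rewrite mulr_gt0.
- rewrite big_split /= prodr_const card_ord -(ltr_pM2l D0) -rmorphM -normrM detadj.
  by rewrite normrX rmorphXn /= mulrCA ltr_pMr // exprn_gt0.
pose t : 'rV[R]_i := (\det B)%:~R^-1 *: map_mx intr (z *m \adj B).
have tB : t *m map_mx intr B = map_mx intr z.
  rewrite -scalemxAl -map_mxM -mulmxA mul_adj_mx mul_mx_scalar map_mxZ scalerA.
  by rewrite mulVf ?scale1r // intr_eq0.
have tb j : `|t ord0 j| < beta (s (lift k j)).
  rewrite mxE normrM normfV -intr_norm mulrC ltr_pdivrMr // mxE mulrC.
  by rewrite -intr_norm; exact: zP.
have Lt : L (lincomb (edges (subtuple s v) k) t).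
  rewrite (lincomb_mul _ eB) tB.
  have [_ Hb] := (lattice_basisE _ _).1 hb.
  by have [|] := (Hb (lincomb b (map_mx intr z))).2; first by exists z.
have [t' t'E sum0] : exists2 t', (t' = t \/ t' = - t) & \sum_j t' ord0 j <= 0.
  case: (leP (\sum_j t ord0 j) 0) => st; first by exists t; [left|].
  exists (- t); first by right.
  under eq_bigr do rewrite mxE; by rewrite sumrN oppr_le0 ltW.
pose c j := edge_barycentric k t' j - (j == k)%:R.
have cl j : c (lift k j) = t' ord0 j.
  by rewrite /c edge_barycentric_lift eq_sym (negPf (neq_lift k j)) subr0.
have ck : c k = - \sum_j t' ord0 j.
  by rewrite /c edge_barycentric_base eqxx addrAC subrr add0r.
have c0 : \sum_j c j = 0.
  rewrite (bigD1_ord k) //= ck; under eq_bigr do rewrite cl.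
  by rewrite addrC subrr.
have g0 : forall j, extend0 s c j = 0.
  apply: no_small_lattice_vector; first by rewrite sum_extend0.
    have -> : \sum_j extend0 s c j *: tnth v j =
        lincomb (edges (subtuple s v) k) t'.
      rewrite comb_extend0; under eq_bigr do rewrite -[tnth v _](tnth_mktuple (fun j => tnth v (s j))).
      rewrite (barycentric_edges _ k) c0 scale0r add0r; congr lincomb.
      by apply/rowP => j; rewrite mxE cl.
    by case: t'E => ->; rewrite ?lincombN //; exact: (lattice_closedN hf).
  move=> j; case: (boolP (j \in codom s)) => [/codomP[l ->]|js].
    rewrite extend0E //; case: (unliftP k l) => [l' ->|->].
      rewrite cl; have := tb l'; rewrite ltr_norml => /andP[t1 t2].
      by case: t'E => -> //; rewrite mxE ltrN2.
    by rewrite ck ltrN2 (le_lt_trans sum0).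
  by rewrite extend0_notin // oppr_lt0.
have t'0 : t' = 0.
  by apply/rowP => j; rewrite mxE -cl -(extend0E c _ si) g0.
have t0 : t = 0 by case: t'E => tt; rewrite -?tt // -[t]opprK -tt t'0 oppr0.
move: z0; have : map_mx intr z = 0 :> 'rV[R]_i by rewrite -tB t0 mul0mx.
move/rowP => zr; case/eqP; apply/rowP => j; have := zr j; rewrite !mxE.
by move/eqP; rewrite intr_eq0 => /eqP.
Qed.

End UniqueInteriorPoint.

(** * Upper bounds on the faces with the largest barycentric coordinates *)

Section UpperBounds.
Variables (R : realType) (V : vectType R).

Lemma conv_hull_perm n (s : 'I_n -> 'I_n) (v : n.-tuple V) :
  injective s -> conv_hull (subtuple s v) = conv_hull v.
Proof.
move=> si; apply/seteqP; split; first exact: conv_hull_subtuple.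
move=> x [c [c0 c1 ->]]; exists (c \o s); split=> [j||] /=; first exact: c0.
  by rewrite -c1 [RHS](reindex_inj si).
by rewrite (reindex_inj si) /=; apply: eq_bigr => j _; rewrite tnth_mktuple.
Qed.

Lemma exists_nonincreasing_perm n (beta : 'I_n -> R) :
  exists2 s : 'I_n -> 'I_n, injective s &
    forall j k : 'I_n, (j <= k)%N -> beta (s k) <= beta (s j).
Proof.
case: n beta => [|n] beta; first by exists id => // -[].
pose r j k := beta k <= beta j.
pose l := sort r (enum 'I_n.+1).
have sl : size l = n.+1 by rewrite size_sort size_enum_ord.
have tr : transitive r by move=> a b c; rewrite /r => h1 h2; exact: le_trans h2 h1.
exists (fun j => nth ord0 l j).
  move=> j k /eqP; rewrite nth_uniq ?sl // => [/eqP/val_inj //|].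
  by rewrite sort_uniq enum_uniq.
move=> j k jk; apply: (sorted_leq_nth tr) => //; rewrite ?inE ?sl //.
  by move=> a; rewrite /r.
by apply: sort_sorted => a b; rewrite /r le_total.
Qed.

(** [inord] spares a proof of [i <= d] in the type; the family is meant for such [i]. *)
Definition initial_vertices d i (v : d.+1.-tuple V) : i.+1.-tuple V :=
  subtuple (fun j : 'I_i.+1 => inord j : 'I_d.+1) v.

Lemma inord_inj d m : (m <= d.+1)%N -> injective (fun j : 'I_m => inord j : 'I_d.+1).
Proof.
move=> md j k /(congr1 val); rewrite /= !inordK ?(leq_trans (ltn_ord _)) //.
exact: val_inj.
Qed.

Lemma initial_vertices_full d (v : d.+1.-tuple V) : initial_vertices d v = v.
Proof. by apply: eq_from_tnth => j; rewrite tnth_mktuple inord_val. Qed.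

Lemma initial_vertices_sub d i (v : d.+1.-tuple V) : (i < d)%N ->
  conv_hull (initial_vertices i v) `<=` conv_hull (initial_vertices i.+1 v).
Proof.
move=> id; rewrite (_ : initial_vertices i v =
  subtuple (fun j : 'I_i.+1 => inord j : 'I_i.+2) (initial_vertices i.+1 v)).
  exact: conv_hull_subtuple.
apply: eq_from_tnth => j; rewrite !tnth_mktuple inordK // ltnS ltnW //.
Qed.

Variables (d : nat) (e f : d.-tuple V) (L : set V).
Hypotheses (he : basis_of {:V} e) (hf : lattice_basis f L).
Variable v : d.+1.-tuple V.
Hypotheses (av : affinely_independent v) (Lv : forall j, L (tnth v j)).
Variable beta : 'I_d.+1 -> R.
Hypotheses (beta_gt0 : forall k, 0 < beta k) (sum_beta : \sum_k beta k = 1).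
Hypothesis Lx : L (\sum_k beta k *: tnth v k).
Hypothesis beta_unique : forall g, (forall k, 0 < g k) -> \sum_k g k = 1 ->
  L (\sum_k g k *: tnth v k) -> g =1 beta.
Hypothesis beta_noninc : forall j k : 'I_d.+1, (j <= k)%N -> beta k <= beta j.

(** Let [P_i] be the product. The last vertex lies outside the family, so
    [P_i <= b_i + ... + b_d <= (d + 1) b_i] by monotonicity. Hence [P_(i+1) >= P_i^2 / (d + 1)], and
    the exponents satisfy [2 (2^i - 1) + 1 = 2^(i+1) - 1]. *)
Lemma barycentric_product_ge i : (i <= d)%N ->
  (d.+1%:R ^+ (2 ^ i - 1))^-1 <= \prod_(j < i) beta (inord j).
Proof.
elim: i => [|i IH] id; first by rewrite expr0 invr1 big_ord0.
have {}IH := IH (ltnW id).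
have le_next : \prod_(j < i) beta (inord j) <= d.+1%:R * beta (inord i).
  have := @barycentric_product_sum _ _ _ _ _ hf v av Lv beta beta_gt0 sum_beta Lx
    beta_unique i (fun j => inord j) ord_max (inord_inj (leqW (ltnW id))).
  have max_notin : ord_max \notin codom (fun j : 'I_i => inord j : 'I_d.+1).
    apply/negP => /codomP[j /(congr1 val)] /=; have := ltn_ord j => ji.
    by rewrite inordK ?(leq_trans ji) ?leqW ?(ltnW id) // => dj; rewrite -dj ltnNge (ltnW id) in ji.
  move=> /(_ max_notin) le_sum; apply: (le_trans le_sum).
  have -> : 1 - \sum_(j < i) beta (inord j) = \sum_(i <= k < d.+1) beta (inord k).
    have -> : 1 = \sum_(0 <= k < d.+1) beta (inord k).
      by rewrite big_mkord -sum_beta; apply: eq_bigr => k _; rewrite inord_val.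
    rewrite -(big_mkord xpredT (fun k => beta (inord k))).
    by rewrite (@big_cat_nat _ _ _ i) /= ?(leqW (ltnW id)) // addrAC subrr add0r.
  apply: (@le_trans _ _ (\sum_(i <= k < d.+1) beta (inord i))).
    apply: ler_sum_nat => k /andP[ik kd]; apply: beta_noninc.
    by rewrite !inordK // (leq_ltn_trans ik).
  rewrite sumr_const_nat -[leLHS]mulr_natl ler_wpM2r ?ler_nat ?leq_subr //.
  exact: ltW.
rewrite big_ord_recr /=.
have P0 : 0 <= \prod_(j < i) beta (inord j).
  by apply: prodr_ge0 => j _; exact: ltW.
have n0 : 0 < d.+1%:R :> R by rewrite ltr0n.
have e0 k : 0 < (d.+1%:R ^+ k)^-1 :> R by rewrite invr_gt0 exprn_gt0.
apply: (@le_trans _ _ ((\prod_(j < i) beta (inord j)) * ((\prod_(j < i) beta (inord j)) / d.+1%:R))).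
  have -> : (d.+1%:R ^+ (2 ^ i.+1 - 1))^-1 =
      (d.+1%:R ^+ (2 ^ i - 1))^-1 * ((d.+1%:R ^+ (2 ^ i - 1))^-1 / d.+1%:R) :> R.
    rewrite -!invfM -exprSr -exprD; congr (_ ^+ _)^-1.
    by have := expn_gt0 2 i; rewrite expnS; lia.
  apply: ler_pM; rewrite ?divr_ge0 ?invr_ge0 ?exprn_ge0 ?ler0n //.
  by rewrite ler_pM2r ?invr_gt0.
by apply: ler_wpM2l => //; rewrite ler_pdivrMr // mulrC.
Qed.

(** With the last vertex of the face as base, the index is at most the inverse of [b_0 ... b_(i-1)];
    this one estimate bounds both the volume and the number of points. *)
Lemma initial_face_bounds i : (0 < i <= d)%N ->
  [/\ is_face (conv_hull v) (conv_hull (initial_vertices i v)),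
      has_dim (conv_hull (initial_vertices i v)) i,
      normalized_volume e L i (conv_hull (initial_vertices i v))
        <= (i`!)%:R^-1 * (d.+1)%:R ^+ (2 ^ i - 1) &
      exists2 n : nat, (conv_hull (initial_vertices i v) `&` L #= `I_n)%card &
        (n <= i + d.+1 ^ (2 ^ i - 1))%N].
Proof.
move=> /andP[i0 id]; set p := initial_vertices i v.
pose s (j : 'I_i.+1) : 'I_d.+1 := inord j.
have si : injective s by exact: inord_inj.
have ap : affinely_independent p := affinely_independent_subtuple si av.
have fe := (free_edges p ord_max).1 ap.
have Lp j : L (tnth p j) by rewrite tnth_mktuple.
have Le j : L (tnth (edges p ord_max) j).
  by rewrite tnth_mktuple; apply: (lattice_closed hf) => //; exact: (lattice_closedN hf).
have Llat := lattice_section hf fe Le.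
rewrite -(direction_conv_hull p ord_max) in Llat.
have [b [hb vol]] := normalized_volume_conv_hull he ord_max ap Llat.
rewrite (direction_conv_hull p ord_max) in hb.
have [B eB] : exists B : 'M[int]_i, forall j,
    tnth (edges p ord_max) j = lincomb b (row j (map_mx intr B)).
  by apply: (lattice_matrix hb) => j; split=> //; exact/memv_span/mem_tnth.
have detB : `|\det B|%:~R <= (d.+1)%:R ^+ (2 ^ i - 1) :> R.
  have := face_index_bound hf av beta_gt0 sum_beta Lx beta_unique si hb eB.
  have := barycentric_product_ge id.
  have -> : \prod_j beta (s (lift ord_max j)) = \prod_(j < i) beta (inord j).
    by apply: eq_bigr => j _; rewrite /s lift_max.
  set P := \prod_(j < i) _ => Pge DP.
  have n0 : 0 < d.+1%:R ^+ (2 ^ i - 1) :> R by rewrite exprn_gt0 ?ltr0n.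
  rewrite -[leLHS]mulr1 -[leRHS]mul1r -ler_pdivrMr // -mulrA mul1r.
  by apply: le_trans DP; apply: ler_wpM2l => //; rewrite ler0z.
split.
- exact: is_face_subtuple.
- exact: has_dim_conv_hull.
- rewrite (vol (map_mx intr B) eB) det_map_mx -intr_norm mulrC.
  by apply: ler_wpM2l => //; rewrite invr_ge0.
- have [n Sn le_n] := count_conv_hull ap hf Lp hb eB.
  exists n => //; apply: (leq_trans le_n); rewrite leq_add2l -(ler_nat R).
  by rewrite natr_absz natrX.
Qed.

End UpperBounds.

(** * The simplex built on Sylvester's sequence *)

(* [sylvester_pred n] is [s_(n+1) - 1] for Sylvester's sequence 2, 3, 7, 43, ... *)
Fixpoint sylvester_pred (n : nat) : nat :=
  if n is m.+1 then (sylvester_pred m * (sylvester_pred m).+1)%N else 1%N.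

Lemma sylvester_pred_gt0 n : (0 < sylvester_pred n)%N.
Proof. by elim: n => //= n IH; rewrite muln_gt0 IH. Qed.

Lemma prod_sylvester n : (\prod_(j < n) (sylvester_pred j).+1)%N = sylvester_pred n.
Proof. by elim: n => [|n IH]; rewrite ?big_ord0 // big_ord_recr /= IH. Qed.

Lemma sylvester_pred_lt j n : (j < n)%N -> ((sylvester_pred j).+1 <= sylvester_pred n)%N.
Proof.
elim: n => // n IH; rewrite ltnS leq_eqVlt => /predU1P[->|/IH le_jn] /=.
  by rewrite leq_pmull // sylvester_pred_gt0.
by apply: (leq_trans le_jn); rewrite leq_pmulr.
Qed.

Lemma sylvester_pred_ge n : (2 ^ 2 ^ n <= sylvester_pred n.+1)%N.
Proof.
elim: n => // n IH; rewrite expnS mulnC expnM.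
have -> : sylvester_pred n.+2 = (sylvester_pred n.+1 * (sylvester_pred n.+1).+1)%N by [].
by rewrite expnS expn1; apply: leq_mul => //; apply: leqW.
Qed.

(** Telescoping: with [u] the value of [sylvester_pred n],
    [1 / u - 1 / (u + 1) = 1 / (u (u + 1))]. *)
Lemma sum_inv_sylvester (K : numFieldType) n :
  \sum_(j < n) ((sylvester_pred j).+1%:R)^-1 = 1 - (sylvester_pred n)%:R^-1 :> K.
Proof.
elim: n => [|n IH]; first by rewrite big_ord0 invr1 subrr.
rewrite big_ord_recr /= IH natrM -natr1.
have s0 : (sylvester_pred n)%:R != 0 :> K by rewrite pnatr_eq0 -lt0n sylvester_pred_gt0.
have s1 : (sylvester_pred n)%:R + 1 != 0 :> K by rewrite natr1 pnatr_eq0.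
by field; rewrite s0 s1.
Qed.

#[local] Arguments sylvester_pred : simpl never.

Section LowerBounds.
Variables (R : realType) (V : vectType R) (d : nat) (e f : d.-tuple V) (L : set V).
Hypotheses (he : basis_of {:V} e) (hf : lattice_basis f L).
Local Notation u := sylvester_pred.

Definition sylvester_vertices : d.+1.-tuple V :=
  [tuple if unlift ord0 k is Some j then (u j).+1%:R *: tnth f j else 0 | k < d.+1].

Lemma sylvester_vertices0 : tnth sylvester_vertices ord0 = 0.
Proof. by rewrite tnth_mktuple unlift_none. Qed.

Lemma sylvester_verticesS j :
  tnth sylvester_vertices (lift ord0 j) = (u j).+1%:R *: tnth f j.
Proof. by rewrite tnth_mktuple liftK. Qed.

Definition sylvester_scaling n : 'M[int]_n := diag_mx (\row_(j < n) (u j).+1%:R).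

Lemma det_sylvester_scaling n : \det (sylvester_scaling n) = (u n)%:R.
Proof.
rewrite det_diag -prod_sylvester natr_prod; apply: eq_bigr => j _; by rewrite mxE.
Qed.

Lemma row_sylvester_scaling n j : row j (map_mx intr (sylvester_scaling n)) =
  (u j).+1%:R *: delta_mx ord0 j :> 'rV[R]_n.
Proof.
apply/rowP => k; rewrite !mxE eqxx /= eq_sym.
case: eqP => _; first by rewrite mulr1n mulr1 rmorph_nat.
by rewrite mulr0n mulr0.
Qed.

Lemma edges_sylvester j : tnth (edges sylvester_vertices ord0) j =
  lincomb f (row j (map_mx intr (sylvester_scaling d))).
Proof.
rewrite tnth_mktuple sylvester_vertices0 subr0 sylvester_verticesS.
by rewrite row_sylvester_scaling lincombZ lincomb_delta.
Qed.

Lemma sylvester_scaling_unit n : map_mx intr (sylvester_scaling n) \in @unitmx R n.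
Proof.
rewrite unitmxE det_map_mx unitfE intr_eq0 det_sylvester_scaling.
by rewrite pnatr_eq0 -lt0n sylvester_pred_gt0.
Qed.

Lemma affinely_independent_sylvester : affinely_independent sylvester_vertices.
Proof.
have [ff _] := hf; apply/(free_edges _ ord0).
exact: (unitmx_free edges_sylvester ff (sylvester_scaling_unit d)).
Qed.

Lemma sylvester_vertices_lattice j : L (tnth sylvester_vertices j).
Proof.
have [_ HL] := (lattice_basisE _ _).1 hf.
case: (unliftP ord0 j) => [k ->|->]; last by rewrite sylvester_vertices0; exact: lattice0 hf.
apply/HL; exists ((u k).+1%:R *: delta_mx ord0 k).
rewrite sylvester_verticesS map_mxZ map_delta_mx lincombZ lincomb_delta.
by rewrite rmorph_nat.
Qed.

Lemma comb_sylvester c : \sum_k c k *: tnth sylvester_vertices k =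
  lincomb f (\row_j (c (lift ord0 j) * (u j).+1%:R)).
Proof.
rewrite (bigD1_ord ord0) //= sylvester_vertices0 scaler0 add0r.
by apply: eq_bigr => j _; rewrite sylvester_verticesS scalerA mxE.
Qed.

(** An interior lattice point has positive integer coordinates [z_j = c_j s_j], so [c_j >= 1 / s_j].
    If some [z_j >= 2], the [c_j] add up to at least [1 - 1 / u d + 1 / s_j >= 1], leaving nothing
    for the vertex 0. *)
Lemma one_interior_point_sylvester :
  one_interior_point_simplices e L (conv_hull sylvester_vertices).
Proof.
have av := affinely_independent_sylvester; have [ff HL] := (lattice_basisE _ _).1 hf.
have un0 n : 0 < (u n)%:R :> R by rewrite ltr0n sylvester_pred_gt0.
split; first by exists sylvester_vertices; split=> //; exact: sylvester_vertices_lattice.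
exists (lincomb f (const_mx 1)); apply/seteqP; split=> [y [inty Ly]|_ ->].
  have [c [c1 yc]] := affine_hull_full he y av.
  have c_gt0 : forall k, 0 < c k.
    by apply/(interior_conv_hull he av c1); rewrite -yc.
  have [z yz] := (HL y).1 Ly.
  have zc j : c (lift ord0 j) * (u j).+1%:R = (z ord0 j)%:~R.
    have : lincomb f (\row_j (c (lift ord0 j) * (u j).+1%:R)) = lincomb f (map_mx intr z).
      by rewrite -comb_sylvester -yc.
    by move/(free_lincomb_inj ff)/rowP/(_ j); rewrite !mxE.
  have z_gt0 j : 0 < z ord0 j by rewrite -(ltr0z R) -zc mulr_gt0 // ltr0n.
  have c_ge (j : 'I_d) : (u j).+1%:R^-1 <= c (lift ord0 j).
    rewrite -[leLHS]mul1r ler_pdivrMr ?ltr0n // zc ler1z.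
    exact: z_gt0.
  suff z1 : z = const_mx 1 by rewrite yz z1; congr lincomb; apply/rowP => j; rewrite !mxE.
  apply/rowP => j; rewrite mxE; apply/eqP; rewrite eq_le; apply/andP; split; last exact: z_gt0.
  rewrite leNgt; apply/negP => z_gt1.
  have cj : (u j).+1%:R^-1 + (u j).+1%:R^-1 <= c (lift ord0 j).
    rewrite -mulr2n -[leLHS]mulr_natl ler_pdivrMr ?ltr0n // zc (_ : 2%:R = 2%:~R) // ler_int.
    exact: z_gt1.
  have : \sum_j c (lift ord0 j) < 1.
    by rewrite -c1 [ltRHS](bigD1_ord ord0) //= ltrDr.
  apply/negP; rewrite -leNgt.
  apply: (@le_trans _ _ ((u j).+1%:R^-1 + \sum_(j < d) (u j).+1%:R^-1)).
    rewrite sum_inv_sylvester addrCA lerDl subr_ge0 lef_pV2 ?posrE ?ltr0n //.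
      by rewrite ler_nat sylvester_pred_lt.
    exact: sylvester_pred_gt0.
  rewrite (bigD1 j) //= addrA [leRHS](bigD1 j) //=; apply: lerD => //.
  by apply: ler_sum => k _.
split; last by apply/HL; exists (const_mx 1); congr lincomb; apply/rowP => j; rewrite !mxE.
pose c := edge_barycentric ord0 (\row_(j < d) ((u j).+1%:R^-1 : R)).
have -> : lincomb f (const_mx 1) = \sum_k c k *: tnth sylvester_vertices k.
  rewrite comb_sylvester; congr lincomb; apply/rowP => j; rewrite !mxE.
  by rewrite /c edge_barycentric_lift mxE mulVf // pnatr_eq0.
apply/(interior_conv_hull he av); first exact: sum_edge_barycentric.
move=> k; case: (unliftP ord0 k) => [j ->|->].
  by rewrite /c edge_barycentric_lift mxE invr_gt0 ltr0n.
rewrite /c edge_barycentric_base; under eq_bigr do rewrite mxE.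
by rewrite sum_inv_sylvester opprB addrC subrK invr_gt0.
Qed.

(** The dimension is [i.+1]. The index is a nonzero multiple of the product of the scaling factors,
    and the longest edge alone carries enough lattice points. *)
Lemma sylvester_face_bounds i : (i < d)%N ->
  let p := initial_vertices i.+1 sylvester_vertices in
  normalized_volume e L i.+1 (conv_hull p) >= (i.+1`!)%:R^-1 * (2 ^+ (2 ^ i) - 1) /\
  exists2 n : nat, (conv_hull p `&` L #= `I_n)%card & ((u i).+1 < n)%N.
Proof.
move=> id p; have [ff HL] := (lattice_basisE _ _).1 hf.
have si : injective (fun j : 'I_i.+2 => inord j : 'I_d.+1) by exact: inord_inj.
have av := affinely_independent_sylvester.
have ap : affinely_independent p := affinely_independent_subtuple si av.
have fe := (free_edges p ord0).1 ap.
have Lp j : L (tnth p j) by rewrite tnth_mktuple; exact: sylvester_vertices_lattice.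
have Le j : L (tnth (edges p ord0) j).
  by rewrite tnth_mktuple; apply: (lattice_closed hf) => //; exact: (lattice_closedN hf).
have Llat := lattice_section hf fe Le.
rewrite -(direction_conv_hull p ord0) in Llat.
have [b [hb vol]] := normalized_volume_conv_hull he ord0 ap Llat.
rewrite (direction_conv_hull p ord0) in hb.
pose g : i.+1.-tuple V := [tuple tnth f (widen_ord id j) | j < i.+1].
have p0 : tnth p ord0 = 0.
  rewrite tnth_mktuple (_ : inord _ = ord0) ?sylvester_vertices0 //.
  by apply: val_inj; rewrite /= inordK.
have pE j : tnth p (lift ord0 j) = (u j).+1%:R *: tnth g j.
  rewrite tnth_mktuple (_ : inord _ = lift ord0 (widen_ord id j)).
    by rewrite sylvester_verticesS tnth_mktuple.
  by apply: val_inj; rewrite /= inordK // /bump /= add1n !ltnS (leq_trans _ id).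
have eg j : tnth (edges p ord0) j =
    lincomb g (row j (map_mx intr (sylvester_scaling i.+1))).
  by rewrite tnth_mktuple p0 subr0 pE row_sylvester_scaling lincombZ lincomb_delta.
have ge j : tnth g j = lincomb (edges p ord0)
    (row j (invmx (map_mx intr (sylvester_scaling i.+1)))).
  by rewrite (lincomb_mul _ eg) -row_mul mulVmx ?sylvester_scaling_unit // row1 lincomb_delta.
(* The basis [b] is not under control; it suffices that the integer matrix [U] has a nonzero
   determinant, hence one of absolute value at least 1. *)
have [U gU] : exists U : 'M[int]_i.+1, forall j,
    tnth g j = lincomb b (row j (map_mx intr U)).
  apply: (lattice_matrix hb) => j; split; last by rewrite mksetE ge; apply/span_lincomb; eexists.
  apply/HL; exists (delta_mx ord0 (widen_ord id j)).
  by rewrite tnth_mktuple map_delta_mx lincomb_delta.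
have fg : free g.
  by apply: (unitmx_free ge fe); rewrite unitmx_inv sylvester_scaling_unit.
have nzU : \det U != 0.
  by have := free_unitmx gU fg; rewrite unitmxE det_map_mx unitfE intr_eq0.
pose B := sylvester_scaling i.+1 *m U.
have eB j : tnth (edges p ord0) j = lincomb b (row j (map_mx intr B)).
  by rewrite eg (lincomb_mul _ gU) -row_mul map_mxM.
split.
  rewrite (vol _ eB) det_map_mx -intr_norm mulrC ler_wpM2r ?invr_ge0 //.
  apply: (@le_trans _ _ (u i.+1)%:R).
    by rewrite lerBlDr ler_wpDr // -natrX ler_nat sylvester_pred_ge.
  rewrite det_mulmx det_sylvester_scaling normrM normr_nat intrM mulrz_nat.
  by rewrite ler_peMr // ler1z -gtz0_ge1 normr_gt0.
(* Used here for finiteness; the lower bound comes from the [u i + 2] points [t f_i],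
   [0 <= t <= s_i], on the last edge. *)
have [n Sn _] := count_conv_hull ap hf Lp hb eB; exists n => //.
pose h (t : nat) : V := t%:R *: tnth g ord_max.
have g0 : tnth g ord_max != 0.
  exact: (free_not0 fg (mem_tnth _ _)).
have hi : {in `I_(u i).+2 &, injective h}.
  move=> t t' _ _ /eqP; rewrite -subr_eq0 -scalerBl scaler_eq0 (negPf g0) orbF.
  by rewrite subr_eq0 eqr_nat => /eqP.
rewrite -card_le_II -(card_le_eqr Sn) -(card_le_eql (inj_card_eq hi)).
apply: subset_card_le => _ [t /= lt_t <-]; split; last first.
  have [_ Hb] := (lattice_basisE _ _).1 hf; apply/Hb.
  exists (t%:R *: delta_mx ord0 (widen_ord id ord_max)).
  by rewrite map_mxZ map_delta_mx rmorph_nat lincombZ lincomb_delta /h tnth_mktuple.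
rewrite (conv_hull_affine_image p ord0).
exists (trow ((t%:R / (u i).+1%:R) *: delta_mx ord0 ord_max)).
  split=> [j|]; first by rewrite tnth_mktuple !mxE mulr_ge0 ?divr_ge0.
  rewrite (bigD1 ord_max) //= big1 ?addr0 => [|j /negPf jm].
    by rewrite tnth_mktuple !mxE !eqxx mulr1 ler_pdivrMr ?ltr0n // mul1r ler_nat -ltnS.
  by rewrite tnth_mktuple !mxE jm andbF mulr0.
rewrite trowK p0 add0r lincombZ lincomb_delta tnth_mktuple p0 subr0 pE scalerA.
by rewrite divfK // pnatr_eq0.
Qed.

End LowerBounds.

(** In dimension 1 the inner exponent is -1 and the bound follows from monotonicity; from dimension
    2 on the exponents are natural numbers. *)
Lemma double_exponent_le (R : realType) i :
  (2 : R) `^ (2 `^ (i.+1%:R - 2)) <= (sylvester_pred i).+2%:R.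
Proof.
case: i => [|i].
  apply: (@le_trans _ _ ((2 : R) `^ 1)); last by rewrite powRr1 // ler_nat.
  apply: ler_powR; first by rewrite ler1n.
  rewrite -[leRHS](powRr0 2); apply: ler_powR; first by rewrite ler1n.
  by rewrite subr_le0 ler_nat.
have -> : i.+2%:R - 2 = i%:R :> R by rewrite -addn2 natrD addrK.
rewrite powR_mulrn // -natrX powR_mulrn // -natrX ler_nat.
by apply: leq_trans (sylvester_pred_ge i) _; rewrite -addn2 leq_addr.
Qed.

(** * Assembly of the upper and lower bounds *)

Theorem theorem1p2 (R : realType) (d : nat) (V : vectType R) (e : d.-tuple V)
    (L : set V) (hd : (1 <= d)%N) (hV : \dim {:V} = d)
    (he : basis_of {:V} e) (hL : is_lattice L d) :
  (forall T : set V, one_interior_point_simplices e L T ->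
     exists G : nat -> set V,
       [/\ forall i, (1 <= i < d)%N -> G i `<=` G i.+1,
           G d = T &
           forall i, (1 <= i <= d)%N ->
             [/\ is_face T (G i),
                 has_dim (G i) i,
                 normalized_volume e L i (G i)
                   <= (i`!)%:R^-1 * (d.+1)%:R ^+ (2 ^ i - 1) &
                 exists2 n : nat, (G i `&` L #= `I_n)%card &
                   (n <= i + d.+1 ^ (2 ^ i - 1))%N]])
  /\
  (exists (T : set V) (G : nat -> set V),
     one_interior_point_simplices e L T /\
       [/\ forall i, (1 <= i < d)%N -> G i `<=` G i.+1,
           G d = T &
           forall i, (1 <= i <= d)%N ->
             [/\ is_face T (G i),
                 has_dim (G i) i,
                 normalized_volume e L i (G i)
                   >= (i`!)%:R^-1 * (2 ^+ (2 ^ (i - 1)) - 1) &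
                 exists2 n : nat, (G i `&` L #= `I_n)%card &
                   n%:R >= (2 : R) `^ (2 `^ (i%:R - 2))]]).
Proof.
have [f hf] := hL; split.
  move=> T [[v0 [Lv0 av0 TE]] [x intx]].
  have [c0 [c01 xc0]] := affine_hull_full he x av0.
  have [s si sP] := exists_nonincreasing_perm c0.
  (* The vertices are renumbered by nonincreasing barycentric coordinates of [x], which does not
     change [T]. *)
  pose v := subtuple s v0; pose c := c0 \o s.
  have av : affinely_independent v by exact: affinely_independent_subtuple.
  have Lv j : L (tnth v j) by rewrite tnth_mktuple.
  have TEv : T = conv_hull v by rewrite conv_hull_perm.
  have c1 : \sum_k c k = 1 by rewrite -c01 [RHS](reindex_inj si).
  have xc : x = \sum_k c k *: tnth v k.
    by rewrite xc0 (reindex_inj si) /=; apply: eq_bigr => k _; rewrite tnth_mktuple.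
  have [intTx Lx] : (interior_in_coords e T `&` L) x by rewrite intx.
  have c_gt0 k : 0 < c k.
    by move: k; apply/(interior_conv_hull he av c1); rewrite -xc -TEv.
  have uniq g : (forall k, 0 < g k) -> \sum_k g k = 1 ->
      L (\sum_k g k *: tnth v k) -> g =1 c.
    move=> g0 g1 Lg; apply: (barycentric_inj av); first by rewrite g1.
    rewrite -xc; have : (interior_in_coords e T `&` L) (\sum_k g k *: tnth v k).
      by split=> //; rewrite TEv; apply/(interior_conv_hull he av g1).
    by rewrite intx.
  rewrite xc in Lx.
  exists (fun i => conv_hull (initial_vertices i v)); split.
  - by move=> i /andP[_ id]; exact: initial_vertices_sub.
  - by rewrite initial_vertices_full.
  - move=> i id; rewrite TEv.
    exact: (initial_face_bounds he hf av Lv c_gt0 c1 Lx uniq sP id).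
pose v := sylvester_vertices f.
exists (conv_hull v), (fun i => conv_hull (initial_vertices i v)).
split; first exact: one_interior_point_sylvester.
(* A positive dimension is a successor, matching the shifted index of [sylvester_face_bounds]. *)
split=> [i /andP[_ id]||[|i] // id].
- exact: initial_vertices_sub.
- by rewrite initial_vertices_full.
have av := affinely_independent_sylvester hf.
have si : injective (fun j : 'I_i.+2 => inord j : 'I_d.+1) by exact: inord_inj.
have [vol [n Sn lt_n]] := sylvester_face_bounds he hf id.
split.
- exact: is_face_subtuple.
- exact/has_dim_conv_hull/affinely_independent_subtuple.
- by rewrite subn1.
- by exists n => //; apply: (le_trans (double_exponent_le R i)); rewrite ler_nat.
Qed.
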